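(* Let $M$ be a closed hyperbolic 3-manifold that fibres over the circle with fibre a closed orientable surface $\Sigma$ of genus $g\ge2$. Fix a hyperbolic metric on $\Sigma$, let $\iota:\mathbb{H}^2\to\mathbb{H}^3$ be the induced map of universal covers of $\Sigma$ and $M$, and let $D_{\mathrm{hyp}}$ be the hyperbolic metric on $\mathbb{H}^3$. There exists a constant $k>0$ such that for $\mu_{\mathrm{Lio}}$-almost every $v\in T^1\Sigma$, the corresponding hyperbolic geodesic ray $\gamma$ satisfies $$D_{\mathrm{hyp}}(\gamma_0,\gamma_T)>kT$$ for all $T$ sufficiently large depending on $v$.
   Context: $M$ is the mapping torus $\Sigma\times[0,1]/\!\sim$ of a pseudo-Anosov monodromy $f$, and $\iota$ is a ($\pi_1(\Sigma)$-equivariant) lift to universal covers of the inclusion of $\Sigma$ in $M$ as the fibre $\Sigma\times\{0\}$. $g_t$ denotes the hyperbolic geodesic flow on the unit tangent bundle $T^1\Sigma$, $\pi:T^1\Sigma\to\Sigma$ the projection and $\mu_{\mathrm{Lio}}$ the $g_t$-invariant Liouville measure. The geodesic ray corresponding to $v$ is $\gamma_t=\pi(g_tv)$, $t\ge0$, lifted to $\mathbb{H}^2$; $D_{\mathrm{hyp}}(\gamma_0,\gamma_T)$ means the $D_{\mathrm{hyp}}$-distance between the images under $\iota$ of the points $\gamma_0,\gamma_T$ of (any) such lift. *)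

(* Defs.v *)
From HB Require Import structures.
From mathcomp Require Import all_boot all_order all_algebra.
From mathcomp Require Import ring lra.
From mathcomp Require Import all_classical all_reals all_analysis.
Set Implicit Arguments.
Unset Strict Implicit.
Unset Printing Implicit Defensive.
Import Order.TTheory GRing.Theory Num.Theory.
Import numFieldNormedType.Exports.
Local Open Scope classical_set_scope.
Local Open Scope ring_scope.
Local Open Scope quotient_scope.

Record homeomorphism (X Y : topologicalType) := Homeomorphism {
  homeo_fun :> X -> Y ;
  homeo_inv : Y -> X ;
  homeo_funK : cancel homeo_fun homeo_inv ;
  homeo_invK : cancel homeo_inv homeo_fun ;
  homeo_continuous : continuous homeo_fun ;
  homeo_inv_continuous : continuous homeo_inv }.

Section real_hyperbolic_functions.
Variable R : realType.
Implicit Types t x : R.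

Definition cosh t : R := (expR t + expR (- t)) / 2.
Definition sinh t : R := (expR t - expR (- t)) / 2.
Definition arcosh x : R := ln (x + Num.sqrt (x ^+ 2 - 1)).

Lemma cosh2B t : cosh t ^+ 2 - sinh t ^+ 2 = 1.
Proof.
have e : expR t * expR (- t) = 1 by rewrite -expRD subrr expR0.
by rewrite -[RHS]e /cosh /sinh; field.
Qed.

End real_hyperbolic_functions.

(* H^n is the upper sheet of the unit hyperboloid of R^(n,1), coordinate 0
   being the timelike one. Isometries act on row vectors by right
   multiplication by matrices. *)
Section hyperbolic_space.
Variables (R : realType) (n : nat).
Implicit Types (x y : 'rV[R]_n.+1) (A B : 'M[R]_n.+1).

Definition lorentz_form x y : R :=
  - (x 0 0 * y 0 0) + \sum_(i < n) x 0 (lift ord0 i) * y 0 (lift ord0 i).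

Lemma lorentz_formC x y : lorentz_form x y = lorentz_form y x.
Proof.
by rewrite /lorentz_form mulrC; congr (_ + _); apply: eq_bigr => i _; rewrite mulrC.
Qed.

Lemma lorentz_form_lin (a b : R) x y z :
  lorentz_form (a *: x + b *: y) z = a * lorentz_form x z + b * lorentz_form y z.
Proof.
rewrite /lorentz_form !mxE !mulrDr !mulr_sumr addrACA -big_split/=.
congr (_ + _); first by ring.
by apply: eq_bigr => i _; rewrite !mxE; ring.
Qed.

Definition hyperboloid : set 'rV[R]_n.+1 :=
  [set x | lorentz_form x x = -1 /\ 0 < x 0 0].

Definition hyp : Type := hyperboloid.
HB.instance Definition _ := Topological.copy hyp (set_type hyperboloid).

Definition hyp_vec (p : hyp) : 'rV[R]_n.+1 := val p.

Definition hyp_dist (p q : hyp) : R :=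
  arcosh (- lorentz_form (hyp_vec p) (hyp_vec q)).

(* The unit tangent vectors of H^n, as pairs (base point, vector). *)
Definition unit_tangent : set ('rV[R]_n.+1 * 'rV[R]_n.+1) :=
  [set v | [/\ hyperboloid v.1, lorentz_form v.1 v.2 = 0
             & lorentz_form v.2 v.2 = 1]].

Definition uthyp : Type := unit_tangent.
HB.instance Definition _ := Topological.copy uthyp (set_type unit_tangent).

Definition uthyp_vec (v : uthyp) : 'rV[R]_n.+1 * 'rV[R]_n.+1 := val v.

Lemma uthypP (v : uthyp) : unit_tangent (uthyp_vec v).
Proof. exact: set_valP. Qed.

Definition base_point (v : uthyp) : hyp :=
  let: And3 h _ _ := uthypP v in SigSub (mem_set h).

Lemma base_pointE v : hyp_vec (base_point v) = (uthyp_vec v).1.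
Proof. by rewrite /base_point; case: (uthypP v). Qed.

Lemma unit_tangent_flow (t : R) v : unit_tangent v ->
  unit_tangent (cosh t *: v.1 + sinh t *: v.2, sinh t *: v.1 + cosh t *: v.2).
Proof.
case: v => x u [/= [xx x0] xu uu].
have ux : lorentz_form u x = 0 by rewrite lorentz_formC.
have cs := cosh2B t.
split => /=; last 2 first.
- by rewrite lorentz_form_lin !(lorentz_formC _ (_ + _)) !lorentz_form_lin
    xx xu ux uu; ring.
- by rewrite lorentz_form_lin !(lorentz_formC _ (_ + _)) !lorentz_form_lin
    xx xu ux uu -[RHS]cs; ring.
split.
  by rewrite lorentz_form_lin !(lorentz_formC _ (_ + _)) !lorentz_form_lin
    xx xu ux uu -[X in _ = - X]cs; ring.
have ux2 : u 0 0 ^+ 2 <= x 0 0 ^+ 2.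
  pose S := \sum_(i < n) (x 0 0 * u 0 (lift ord0 i) - u 0 0 * x 0 (lift ord0 i)) ^+ 2.
  have S0 : 0 <= S by apply: sumr_ge0 => i _; exact: sqr_ge0.
  rewrite -subr_ge0; suff -> : x 0 0 ^+ 2 - u 0 0 ^+ 2 = S by [].
  pose a := \sum_(i < n) x 0 (lift ord0 i) * x 0 (lift ord0 i).
  pose b := \sum_(i < n) x 0 (lift ord0 i) * u 0 (lift ord0 i).
  pose c := \sum_(i < n) u 0 (lift ord0 i) * u 0 (lift ord0 i).
  have -> : S = x 0 0 ^+ 2 * c - 2 * x 0 0 * u 0 0 * b + u 0 0 ^+ 2 * a.
    rewrite /S /a /b /c !mulr_sumr -sumrB -big_split /=.
    by apply: eq_bigr => i _; ring.
  move: xx xu uu; rewrite /lorentz_form -/a -/b -/c => xx xu uu.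
  have -> : a = x 0 0 ^+ 2 - 1 by rewrite -xx; ring.
  have -> : b = x 0 0 * u 0 0 by apply/eqP; rewrite -subr_eq0 addrC xu.
  have -> : c = 1 + u 0 0 ^+ 2 by rewrite -uu; ring.
  by ring.
have : `|u 0 0| <= x 0 0 by rewrite -ler_sqr ?nnegrE ?(ltW x0)// real_normK ?num_real.
rewrite ler_norml => /andP[u1 u2]; rewrite !mxE /cosh /sinh.
have e1 : 0 < expR t by exact: expR_gt0.
have e2 : 0 < expR (- t) by exact: expR_gt0.
have [u0|u0] := leP 0 (u 0 0); nra.
Qed.

Definition geodesic_flow (t : R) (v : uthyp) : uthyp :=
  SigSub (mem_set (unit_tangent_flow t (uthypP v))).

(* The full isometry group of H^n. *)
Definition hyp_isometry : set 'M[R]_n.+1 :=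
  [set A | [/\ A \in unitmx,
     forall x y, lorentz_form (x *m A) (y *m A) = lorentz_form x y &
     forall x, hyperboloid x -> hyperboloid (x *m A)]].

Record isometry_group := IsometryGroup {
  isometries :> 'M[R]_n.+1 -> Prop ;
  isometries_sub : isometries `<=` hyp_isometry ;
  isometries1 : isometries 1%:M ;
  isometriesM : forall A B, isometries A -> isometries B -> isometries (A *m B) ;
  isometriesV : forall A, isometries A -> isometries (invmx A) }.

Section quotient.
Variable G : isometry_group.

Definition orbit_rel (p q : hyp) : bool :=
  `[< exists2 A, G A & hyp_vec q = hyp_vec p *m A >].

Lemma orbit_rel_refl : reflexive orbit_rel.
Proof. by move=> p; apply/asboolP; exists 1%:M; [exact: isometries1|rewrite mulmx1]. Qed.

Lemma orbit_rel_sym : symmetric orbit_rel.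
Proof.
suff H p q : orbit_rel p q -> orbit_rel q p by move=> p q; apply/idP/idP => /H.
move=> /asboolP[A GA qE]; apply/asboolP; exists (invmx A); first exact: isometriesV.
by have [uA _ _] := isometries_sub GA; rewrite qE mulmxK.
Qed.

Lemma orbit_rel_trans : transitive orbit_rel.
Proof.
move=> q p r /asboolP[A GA qE] /asboolP[B GB rE]; apply/asboolP.
by exists (A *m B); [exact: isometriesM|rewrite rE qE mulmxA].
Qed.

Definition orbit_equiv :=
  EquivRel orbit_rel orbit_rel_refl orbit_rel_sym orbit_rel_trans.

Definition hyp_quotient := quotient_topology {eq_quot orbit_equiv}.

Definition ut_orbit_rel (v w : uthyp) : bool :=
  `[< exists2 A, G A & uthyp_vec w = ((uthyp_vec v).1 *m A, (uthyp_vec v).2 *m A) >].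

Lemma ut_orbit_rel_refl : reflexive ut_orbit_rel.
Proof.
move=> p; apply/asboolP; exists 1%:M; first exact: isometries1.
by rewrite !mulmx1; case: (uthyp_vec p).
Qed.

Lemma ut_orbit_rel_sym : symmetric ut_orbit_rel.
Proof.
suff H p q : ut_orbit_rel p q -> ut_orbit_rel q p.
  by move=> p q; apply/idP/idP => /H.
move=> /asboolP[A GA qE]; apply/asboolP; exists (invmx A); first exact: isometriesV.
have [uA _ _] := isometries_sub GA.
by rewrite qE /= !mulmxK//; case: (uthyp_vec p).
Qed.

Lemma ut_orbit_rel_trans : transitive ut_orbit_rel.
Proof.
move=> q p r /asboolP[A GA qE] /asboolP[B GB rE]; apply/asboolP.
by exists (A *m B); [exact: isometriesM|rewrite rE qE !mulmxA].
Qed.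

Definition ut_orbit_equiv :=
  EquivRel ut_orbit_rel ut_orbit_rel_refl ut_orbit_rel_sym ut_orbit_rel_trans.

Definition ut_quotient := quotient_topology {eq_quot ut_orbit_equiv}.

Definition hyp_proj : hyp -> hyp_quotient := \pi_hyp_quotient.
Definition ut_proj : uthyp -> ut_quotient := \pi_ut_quotient.

Definition free_action : Prop :=
  forall A (p : hyp), G A -> hyp_vec p *m A = hyp_vec p -> A = 1%:M.

Definition properly_discontinuous : Prop :=
  forall K : set hyp, compact K ->
    finite_set [set A | G A /\
      exists p q, [/\ K p, K q & hyp_vec q = hyp_vec p *m A]].

(* Closed hyperbolic n-manifolds are the compact quotients H^n / G by free
   properly discontinuous groups of isometries. For n = 2 the genus of an
   orientable quotient is at least 2 by Gauss-Bonnet. *)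
Definition closed_hyperbolic_manifold : Prop :=
  [/\ free_action, properly_discontinuous & compact [set: hyp_quotient]].

(* An isometry of H^n preserves orientation iff its matrix has determinant 1. *)
Definition orientable : Prop := forall A, G A -> \det A = 1.

End quotient.
End hyperbolic_space.

(* A space fibres over the circle with fibre S iff it is homeomorphic to
   S x [0, 1] / (x, 1) ~ (f x, 0) for some homeomorphism f of S. *)
Section mapping_torus.
Variables (R : realType) (S : topologicalType) (f : homeomorphism S S).

Definition unit_interval : Type := `[0, 1]%classic : set R.
HB.instance Definition _ :=
  Topological.copy unit_interval (set_type (`[0, 1]%classic : set R)).

Definition interval_val (s : unit_interval) : R := val s.

Lemma interval0_subproof : (0 : R) \in (`[0, 1]%classic : set R).
Proof. by rewrite inE /= in_itv /= lexx ler01. Qed.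
Definition interval0 : unit_interval := SigSub interval0_subproof.

Definition torus_rel (p q : S * unit_interval) : bool :=
  `[< [\/ p = q,
       [/\ interval_val p.2 = 1, interval_val q.2 = 0 & q.1 = f p.1] |
       [/\ interval_val p.2 = 0, interval_val q.2 = 1 & p.1 = f q.1]] >].

Lemma torus_rel_refl : reflexive torus_rel.
Proof. by move=> p; apply/asboolP; exact: Or31. Qed.

Lemma torus_rel_sym : symmetric torus_rel.
Proof.
suff H p q : torus_rel p q -> torus_rel q p by move=> p q; apply/idP/idP => /H.
move=> /asboolP[->|H|H]; apply/asboolP; [exact: Or31|apply: Or33|apply: Or32].
  by case: H.
by case: H.
Qed.

Lemma torus_rel_trans : transitive torus_rel.
Proof.
have fI : injective f := can_inj (homeo_funK f).
have n01 : (0 : R) <> 1 by move/esym/eqP; rewrite oner_eq0.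
move=> [q s] [p r] [z t] /asboolP H1 /asboolP H2; apply/asboolP.
have vI : injective interval_val by exact: val_inj.
case: H1 H2 => [->//|[/= r1 s0 qE]|[/= r0 s1 pE]].
  case=> [[<- <-]|[/= s1 _ _]|[/= _ t1 qE']]; first by apply: Or32.
    by exfalso; apply: n01; rewrite -s0 -s1.
  apply: Or31; congr (_, _); first by apply: fI; rewrite -qE -qE'.
  by apply: vI; rewrite r1 t1.
case=> [[<- <-]|[/= _ t0 zE]|[/= s0 _ _]]; first by apply: Or33.
  by apply: Or31; congr (_, _); [rewrite pE zE|apply: vI; rewrite r0 t0].
by exfalso; apply: n01; rewrite -s0 -s1.
Qed.

Definition torus_equiv :=
  EquivRel torus_rel torus_rel_refl torus_rel_sym torus_rel_trans.

Definition mapping_torus := quotient_topology {eq_quot torus_equiv}.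

Definition fibre (x : S) : mapping_torus := \pi_mapping_torus (x, interval0).

End mapping_torus.

Arguments mapping_torus R {S} f.

(* iota is a pi_1-equivariant lift of the inclusion of the fibre S x {0},
   transported to the 3-manifold by the homeomorphism h. *)
Definition fibre_lift (R : realType) (G : isometry_group R 2)
    (L : isometry_group R 3)
    (f : homeomorphism (hyp_quotient G) (hyp_quotient G))
    (h : homeomorphism (mapping_torus R f) (hyp_quotient L))
    (iota : hyp R 2 -> hyp R 3) : Prop :=
  [/\ continuous iota,
      forall p, hyp_proj L (iota p) = h (fibre R f (hyp_proj G p)) &
      forall A, G A -> exists2 B, L B & forall p q,
        hyp_vec q = hyp_vec p *m A ->
        hyp_vec (iota q) = hyp_vec (iota p) *m B].

Section liouville.
Variable R : realType.

Definition row3 (a b c : R) : 'rV[R]_3 := \row_(i < 3) [:: a; b; c]`_i.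

Lemma lorentz_form_row3 a b c a' b' c' :
  lorentz_form (row3 a b c) (row3 a' b' c') = - (a * a') + (b * b' + c * c').
Proof. by rewrite /lorentz_form !big_ord_recl big_ord0 !mxE /= addr0. Qed.

(* Polar coordinates: the base point is at distance r from (1, 0, 0) in
   direction phi, and the vector makes the angle theta with the outward
   radial unit vector. *)
Definition ut_polar_vec (c : R * R * R) : 'rV[R]_3 * 'rV[R]_3 :=
  let: (r, phi, theta) := c in
  (row3 (cosh r) (sinh r * cos phi) (sinh r * sin phi),
   cos theta *: row3 (sinh r) (cosh r * cos phi) (cosh r * sin phi)
   + sin theta *: row3 0 (- sin phi) (cos phi)).

Lemma ut_polar_subproof c : unit_tangent (ut_polar_vec c).
Proof.
case: c => [[r phi] theta].
have h := cosh2B r; have h1 := cos2Dsin2 phi; have h2 := cos2Dsin2 theta.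
have hs : sinh r ^+ 2 = cosh r ^+ 2 - 1 by rewrite -h; ring.
have s1 : sin phi ^+ 2 = 1 - cos phi ^+ 2 by rewrite -h1; ring.
have s2 : sin theta ^+ 2 = 1 - cos theta ^+ 2 by rewrite -h2; ring.
split=> /=.
- split; last first.
    by rewrite mxE /= /cosh divr_gt0// addr_gt0// expR_gt0.
  rewrite lorentz_form_row3; ring: hs s1 s2.
- rewrite lorentz_formC lorentz_form_lin !lorentz_form_row3; ring: hs s1 s2.
- rewrite lorentz_form_lin !(lorentz_formC _ (_ + _)) !lorentz_form_lin.
  rewrite !lorentz_form_row3; ring: hs s1 s2.
Qed.

Definition ut_polar (c : R * R * R) : uthyp R 2 :=
  SigSub (mem_set (ut_polar_subproof c)).

HB.instance Definition _ := isPointed.Build (uthyp R 2) (ut_polar (0, 0, 0)).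

Variable G : isometry_group R 2.

Definition ut_borel := g_sigma_algebraType (@open (ut_quotient G)).

Definition dirichlet_domain : set (hyp R 2) :=
  let o := base_point (ut_polar (0, 0, 0)) in
  [set p | forall q, orbit_rel G o q -> hyp_dist p o <= hyp_dist p q].

(* Hyperbolic area times angle is sinh r dr dphi dtheta in polar coordinates.
   The Liouville measure of T^1 S is the image of its restriction to the
   fundamental domain, whose translates cover H^2 and overlap only along
   their boundaries, which are null. *)
Definition polar_domain : set (R * R * R) :=
  [set c | [/\ 0 <= c.1.1, 0 <= c.1.2 < 2 * pi, 0 <= c.2 < 2 * pi &
               dirichlet_domain (base_point (ut_polar c))]].

Definition liouville (B : set ut_borel) : \bar R :=
  (\int[(@lebesgue_measure R \x @lebesgue_measure R) \x @lebesgue_measure R]_(c in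
      polar_domain `&` [set c | B (ut_proj G (ut_polar c))])
    (sinh c.1.1)%:E)%E.

End liouville.

(* Main.v *)
Require Import Defs.
From mathcomp Require Import all_boot all_order all_algebra.
From mathcomp Require Import zify ring lra.
From mathcomp Require Import all_classical all_reals all_analysis.
From mathcomp Require Import measurable_realfun.
Import Order.TTheory GRing.Theory Num.Theory.
Import numFieldNormedType.Exports.
Set Implicit Arguments.
Unset Strict Implicit.
Unset Printing Implicit Defensive.
Local Open Scope classical_set_scope.
Local Open Scope ring_scope.
Local Open Scope quotient_scope.

(** Two counts are played against each other.

    In the hyperbolic plane, geodesic rays diverge exponentially: by the law of
    cosines ([polar_ray_dist], [polar_angle_le]), the directions at a given
    point whose rays meet a given translate of a compact fundamental domain at
    some time in [n+1, n+2] lie within O(exp(- n)) of each other.  In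
    hyperbolic 3-space, an orbit of the discrete group L has O(Z^3) points at
    height at most Z, the height being the timelike coordinate, comparable with
    the exponential of the distance: in the remaining coordinates the orbit is
    separated for the Euclidean metric, so that each small cube contains at most
    one point of it ([orbit_separated], [grid_cellP]).  If the image of a ray
    stays within distance k T of its origin at a time T in [n+1, n+2], then the
    translate that the ray visits at that time is sent to a region of height
    O(exp(k n)), hence is one of O(exp(3 k n)) translates, provided that
    distinct translates have distinct images.  So the set of such directions has
    measure O(exp((3 k - 1) n)) ([slow_directions_clustered]).  This is summable
    for k < 1/3, here k = 1/6, and the Borel-Cantelli lemma shows that almost
    every direction at every point is eventually fast.  Fubini's theorem in
    polar coordinates turns this into a statement about the Liouville measure.

    What makes images of distinct translates distinct is the injectivity of
    iota ([fibre_lift_injective]), that is, the incompressibility of the fibre.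
    The projection of H^3 to M, seen as a map to the mapping torus, lifts to
    the infinite cyclic cover S x R because balls of H^3 are contractible; its
    first component is a map to S, which lifts to H^2 for the same reason.
    By uniqueness of lifts along paths, the composite of iota with the resulting
    map from a ball of H^3 to H^2 is the identity on any path that iota sends
    into that ball. *)

(** * Lifting through coverings *)

(** A covering map P, presented by a relation N of nearness on the total space:
    two points near to a common point are equal as soon as they lie over the
    same point.  A relation preserved by enough deck transformations takes the
    place of evenly covered open sets because it selects lifts canonically:
    lifts defined locally by nearness agree without any connectedness
    argument. *)
Record nearness_cover (E B : topologicalType) (P : E -> B)
    (N : E -> E -> Prop) : Prop := NearnessCover {
  cover_surj : forall b, exists e, P e = b ;
  cover_open : forall W : set E, open W -> open (P @` W) ;
  nearness_open : forall e e', N e e' ->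
    \forall x \near (e, e'), N x.1 x.2 ;
  nearness_refl : forall e, N e e ;
  nearness_sym : forall e e', N e e' -> N e' e ;
  nearness_sep : forall e e1 e2, N e e1 -> N e e2 -> P e1 = P e2 -> e1 = e2 ;
  nearness_homog : forall e1 e2, P e1 = P e2 -> exists g : E -> E,
    [/\ g e1 = e2, forall x, P (g x) = P x &
        forall x y, N x y -> N (g x) (g y)] }.

Section cover_lifting.
Variables (R : realType) (E B : topologicalType) (P : E -> B).
Variables (N : E -> E -> Prop) (cov : nearness_cover P N).

(** The unique point over b that is near e; e itself is a dummy value. *)
Definition transport (e : E) (b : B) : E :=
  match pselect (exists e', N e e' /\ P e' = b) with
  | left ex => projT1 (cid ex)
  | right _ => e
  end.

Lemma transportP e b : (exists e', N e e' /\ P e' = b) ->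
  N e (transport e b) /\ P (transport e b) = b.
Proof. by rewrite /transport; case: pselect => // ex _; case: (cid ex). Qed.

Lemma transport_eq e b e' : N e e' -> P e' = b -> transport e b = e'.
Proof.
move=> Nee' Pe'; have [|Ne Pb] := @transportP e b; first by exists e'.
by apply: (nearness_sep cov Ne Nee'); rewrite Pb.
Qed.

(** Any neighbourhood of the transported point has an open image, hence contains
    points over all nearby values of q; since nearness is an open condition,
    uniqueness forces these points to be the transported ones. *)
Lemma transport_continuous (X : topologicalType) (g : X -> E) (q : X -> B) x :
  {for x, continuous g} -> {for x, continuous q} ->
  (exists e', N (g x) e' /\ P e' = q x) ->
  {for x, continuous (fun y => transport (g y) (q y))}.
Proof.
move=> gx qx /transportP; set t := transport _ _ => -[Nt Pt] W /= tW.
have [[W1 W2] /= [W1g W2t] WN] := nearness_open cov Nt.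
have [U [oU Ut UW]] : exists U : set E, [/\ open U, U t & U `<=` W `&` W2].
  have : nbhs t (W `&` W2) by apply: filterI.
  by rewrite nbhsE => -[U [oU Ut] UW]; exists U.
have PO : nbhs (q x) (P @` U).
  apply: open_nbhs_nbhs; split; first exact: (cover_open cov).
  by rewrite -Pt; exists t.
have gW1 := gx _ W1g.
have qPO := qx _ PO.
rewrite /nbhs /=; near=> y.
have [e' Ue' Pe'] : (P @` U) (q y) by near: y; exact: qPO.
have W1y : W1 (g y) by near: y; exact: gW1.
have [We' W2e'] := UW _ Ue'.
rewrite /= (@transport_eq _ _ e') //.
by apply: (WN (g y, e')).
Unshelve. all: by end_near. Qed.

(** Agreement of the two lifts is locally constant: close to s, each lift stays
    near its value at s, and nearness separates points of a fibre. So the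
    indicator of agreement is continuous and the intermediate value theorem
    forbids it to drop from 1 to 0. *)
Lemma cover_lift_unique_end (g1 g2 : R -> E) :
  {in `[0, 1]%R, forall s : R, {for s, continuous g1}} ->
  {in `[0, 1]%R, forall s : R, {for s, continuous g2}} ->
  {in `[0, 1]%R, forall s, P (g1 s) = P (g2 s)} ->
  g1 0 = g2 0 -> g1 1 = g2 1.
Proof.
move=> c1 c2 Pg g0; apply: contrapT => g1n.
pose chi (s : R) : R := if pselect (g1 s = g2 s) then 1 else 0.
have chi_cst (s : R) : s \in `[0, 1]%R ->
    \forall s' \near s, s' \in `[0, 1]%R -> chi s' = chi s.
  move=> s01.
  have N1 : \forall s' \near s, N (g1 s) (g1 s').
    have /c1 := s01; apply.
    have [[W1 W2] /= [/nbhs_singleton W1g W2g] WN] :=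
      nearness_open cov (nearness_refl cov (g1 s)).
    by apply: filterS W2g => e W2e; apply: (WN (_, _)).
  have N2 : \forall s' \near s, N (g2 s) (g2 s').
    have /c2 := s01; apply.
    have [[W1 W2] /= [/nbhs_singleton W1g W2g] WN] :=
      nearness_open cov (nearness_refl cov (g2 s)).
    by apply: filterS W2g => e W2e; apply: (WN (_, _)).
  near=> s' => s'01.
  have n1 : N (g1 s) (g1 s') by near: s'.
  have n2 : N (g2 s) (g2 s') by near: s'.
  rewrite /chi; case: pselect => [e'|ne']; case: pselect => [e|ne] //.
    case: ne; apply: (nearness_sep cov (e := g1 s')); last exact: Pg.
      exact: (nearness_sym cov).
    by rewrite e'; exact: (nearness_sym cov).
  case: ne'; apply: (nearness_sep cov (e := g1 s)) => //; last exact: Pg.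
  by rewrite e.
have chi_cont : {within `[0, 1], continuous chi}.
  apply/subspace_continuousP => s; rewrite /= => s01.
  by apply: cvg_near_cst; exact: (chi_cst s s01).
have chi0 : chi 0 = 1 by rewrite /chi; case: pselect.
have chi1 : chi 1 = 0 by rewrite /chi; case: pselect.
have mid : Num.min (chi 0) (chi 1) <= 2^-1 <= Num.max (chi 0) (chi 1).
  by rewrite chi0 chi1 min_r ?max_l ?ler01 ?invr_ge0 ?ler0n ?invf_le1 ?ler1n.
have [c cI chic] := IVT ler01 chi_cont mid.
move: chic.
rewrite /chi; case: (pselect (g1 c = g2 c)) => ? /=; last first.
  by apply/eqP; rewrite eq_sym invr_eq0 pnatr_eq0.
by apply/eqP; rewrite eq_sym invr_eq1 pnatr_eq1.
Unshelve. all: by end_near. Qed.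

Lemma cover_lift_unique (g1 g2 : R -> E) :
  {in `[0, 1]%R, forall s : R, {for s, continuous g1}} ->
  {in `[0, 1]%R, forall s : R, {for s, continuous g2}} ->
  {in `[0, 1]%R, forall s, P (g1 s) = P (g2 s)} ->
  g1 0 = g2 0 -> {in `[0, 1]%R, g1 =1 g2}.
Proof.
move=> c1 c2 Pg g0 t; rewrite in_itv /= => /andP[t0 t1].
have st s : s \in `[0, 1]%R -> s * t \in `[0, 1]%R.
  rewrite !in_itv /= => /andP[s0 s1]; rewrite mulr_ge0//=.
  by rewrite -[1]mul1r ler_pM.
have ct s : {for s, continuous (fun s : R => s * t)} by exact: mulrr_continuous.
rewrite -[t]mul1r.
apply: (@cover_lift_unique_end (fun s => g1 (s * t)) (fun s => g2 (s * t))).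
- by move=> s /st s01; apply: (continuous_comp (ct s)); exact: c1.
- by move=> s /st s01; apply: (continuous_comp (ct s)); exact: c2.
- by move=> s /st; exact: Pg.
- by rewrite !mul0r.
Qed.

Variables (V : normedModType R).
Implicit Types (q : V -> B) (r : R).

(** Compactness provides a single scale below which transport is possible; deck
    transformations make this scale independent of the sheet in which the
    transport starts. *)
Lemma uniform_transport q r :
  compact [set x : V | `|x| <= r] ->
  (forall x, `|x| <= r -> {for x, continuous q}) ->
  exists2 d : R, 0 < d & forall x y e, `|x| <= r -> `|x - y| < d -> P e = q x ->
    exists e', N e e' /\ P e' = q y.
Proof.
move=> /compact_near_coveringP cpt qc.
have /cpt : forall x, [set x : V | `|x| <= r] x -> \forall x' \near x & d \near 0^'+,
    (fun d x => forall y e, `|x - y| < d -> P e = q x ->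
      exists e', N e e' /\ P e' = q y) d x'.
  move=> x /= xr.
  have [e0 Pe0] := cover_surj cov (q x).
  have [[W1 W2] /= [W1e W2e] WN] := nearness_open cov (nearness_refl cov e0).
  have PW : nbhs (q x) (P @` (W1 `&` W2)).
    have : nbhs e0 (W1 `&` W2) by apply: filterI.
    rewrite nbhsE => -[U [oU Ue] UW].
    apply: (@filterS _ _ _ (P @` U)).
      by move=> _ [e Ue' <-]; exists e => //; exact: UW.
    by apply: open_nbhs_nbhs; split; [exact: (cover_open cov)|exists e0].
  have /(qc x xr)/nbhs_ballP[eps /= eps0 qB] := PW.
  have he : 0 < eps / 2 by lra.
  exists (ball x (eps / 2), [set d | d <= eps / 2]).
    split => /=; first exact: nbhsx_ballx.
    exact: nbhs_right_le.
  move=> [x' d] /= [xx' de] y e x'y Pe.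
  have le_eps : eps / 2 <= eps by lra.
  have [e1 [W1e1 _] Pe1] := qB _ (le_ball le_eps xx').
  have [e2 [_ W2e2] Pe2] : (P @` (W1 `&` W2)) (q y).
    apply: qB; rewrite (splitr eps); apply: (ball_triangle xx').
    by rewrite -ball_normE /=; apply: lt_le_trans de.
  have [g [ge Pg Ng]] := nearness_homog cov (etrans Pe1 (esym Pe)).
  exists (g e2); rewrite -ge Pg; split => //.
  by apply: Ng; apply: (WN (e1, e2)).
move=> H; have [d] := filter_ex (filterI H (@nbhs_right_gt R 0)).
move=> [/= dH d0]; exists d => // x y e xr xy Pe; exact: (dH x xr y e xy Pe).
Qed.

(** Contract the ball to its centre: the maps [x |-> q ((i / m) x)] interpolate
    between a constant map, which lifts, and q.  For m large each of them is
    uniformly close to the next one, so lifts are transported step by step. *)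
Lemma cover_lift q r e0 :
  compact [set x : V | `|x| <= r] ->
  (forall x, `|x| <= r -> {for x, continuous q}) -> P e0 = q 0 ->
  exists g : V -> E, [/\ g 0 = e0,
    forall x, `|x| < r -> {for x, continuous g} &
    forall x, `|x| < r -> P (g x) = q x].
Proof.
move=> cpt qc Pe0.
have [r0|r0] := ltP 0 r; last first.
  by exists (fun=> e0); split => // x; rewrite ltNge (le_trans r0).
have [d d0 dP] := uniform_transport cpt qc.
pose m := (Num.truncn (r / d)).+1.
have m0 : 0 < m%:R :> R by rewrite ltr0n.
have rm : r / m%:R < d.
  by rewrite ltr_pdivrMr// mulrC -ltr_pdivrMr//; exact: truncnS_gt.
have scale_le i x : (i <= m)%N -> `|x| <= r -> `|(i%:R / m%:R : R) *: x| <= r.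
  move=> im xr; rewrite normrZ ger0_norm ?divr_ge0 ?ler0n//.
  by apply: le_trans xr; rewrite ler_piMl// ler_pdivrMr// mul1r ler_nat.
suff /(_ m (leqnn m))[g [g0 gc gP]] : forall i, (i <= m)%N ->
    exists g : V -> E, [/\ g 0 = e0,
      forall x, `|x| < r -> {for x, continuous g} &
      forall x, `|x| < r -> P (g x) = q ((i%:R / m%:R) *: x)].
  by exists g; split=> // x xr; rewrite gP// divff ?scale1r ?lt0r_neq0.
elim=> [_|i IH im].
  exists (fun=> e0); split => // x _; first exact: cvg_cst.
  by rewrite mul0r scale0r.
have [g [g0 gc gP]] := IH (ltnW im).
have ex x : `|x| < r -> exists e', N (g x) e' /\ P e' = q ((i.+1%:R / m%:R) *: x).
  move=> xr; apply: (dP _ _ _ _ _ (gP x xr)).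
    exact: scale_le (ltnW im) (ltW xr).
  rewrite -scalerBl -mulrBl -natr1 opprD addNKr mulNr mul1r normrZ normrN.
  rewrite gtr0_norm ?invr_gt0//; apply: le_lt_trans rm.
  by rewrite mulrC ler_pM2r ?invr_gt0// ltW.
exists (fun x => transport (g x) (q ((i.+1%:R / m%:R) *: x))); split.
- rewrite scaler0 g0; apply: transport_eq => //; exact: (nearness_refl cov).
- move=> x xr; apply: transport_continuous; [exact: gc| |exact: ex].
  apply: (@continuous_comp _ _ _ (fun x => (i.+1%:R / m%:R : R) *: x) q).
    exact: scaler_continuous.
  by apply: qc; apply: scale_le => //; exact: ltW.
- by move=> x xr; have [] := transportP (ex x xr).
Qed.

End cover_lifting.

(** * Coordinates on the hyperboloid *)

Lemma eq_continuous_at (X Y : topologicalType) (f g : X -> Y) x :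
  f =1 g -> continuous_at x f -> continuous_at x g.
Proof. by move=> /funext ->. Qed.

Lemma continuous_sumR (R : realType) (X : topologicalType) (n : nat)
    (f : 'I_n -> X -> R) x :
  (forall i, continuous_at x (f i)) ->
  continuous_at x (fun y => \sum_(i < n) f i y).
Proof.
move=> fc; elim: n f fc => [|n IH] f fc.
  by apply: (@eq_continuous_at _ _ (fun=> 0)); [move=> y; rewrite big_ord0|exact: cvg_cst].
apply: (@eq_continuous_at _ _ (fun y => f ord0 y + \sum_(i < n) f (lift ord0 i) y)).
  by move=> y; rewrite big_ord_recl.
by apply: cvgD; [exact: fc|apply: IH => i; exact: fc].
Qed.

Lemma continuous_at_lt (R : realType) (X : topologicalType) (f : X -> R) x a :
  continuous_at x f -> f x < a -> \forall y \near x, f y < a.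
Proof. by move=> fc fa; exact: (fc [set z | z < a] (lt_nbhsl fa)). Qed.

Lemma continuous_at_gt (R : realType) (X : topologicalType) (f : X -> R) x a :
  continuous_at x f -> a < f x -> \forall y \near x, a < f y.
Proof. by move=> fc fa; exact: (fc [set z | a < z] (lt_nbhsr fa)). Qed.

Lemma continuous_mx_entries (R : realType) (X : topologicalType) m n
    (f : X -> 'M[R]_(m, n)) x :
  (forall i j, continuous_at x (fun y => f y i j)) ->
  continuous_at x f.
Proof.
move=> fc A [Q fQ QA].
have H : \forall y \near x, forall ij : 'I_m * 'I_n, Q ij.1 ij.2 (f y ij.1 ij.2).
  by apply: filter_forall => -[i j] /=; exact: (fc i j).
by apply: filterS H => y Hy; apply: QA => i j; exact: (Hy (i, j)).
Qed.

Lemma continuous_at_comp (X Y Z : topologicalType) (f : X -> Y) (g : Y -> Z) x :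
  continuous_at x f -> continuous g -> continuous_at x (fun y => g (f y)).
Proof. by move=> fc gc; apply: (@continuous_comp _ _ _ f g) => //; exact: gc. Qed.

Lemma continuous_at_pair (X Y Z : topologicalType) (f : X -> Y) (g : X -> Z) x :
  continuous_at x f -> continuous_at x g -> continuous_at x (fun y => (f y, g y)).
Proof.
move=> fc gc W [[W1 W2] /= [fW1 gW2] WW].
have h1 : \forall y \near x, W1 (f y) by exact: (fc W1 fW1).
have h2 : \forall y \near x, W2 (g y) by exact: (gc W2 gW2).
change (\forall y \near x, W (f y, g y)).
by apply: filterS2 h1 h2 => y y1 y2; apply: WW.
Qed.

Lemma continuous_set_type (X Y : topologicalType) (A : set Y) (f : X -> A) x :
  continuous_at x (fun y => set_val (f y)) -> continuous_at x f.
Proof.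
move=> fc W; rewrite nbhsE => -[U [oU Ux] UW].
case: oU => V oV VU; move: Ux; rewrite -VU => Vx.
have fV : \forall y \near x, V (set_val (f y)).
  exact: (fc V (open_nbhs_nbhs (conj oV Vx))).
change (\forall y \near x, W (f y)).
by apply: filterS fV => y Vy; apply: UW; rewrite -VU.
Qed.

Section hyperbolic_coordinates.
Variables (R : realType) (n : nat).
Implicit Types (p q : hyp R n) (A B : 'M[R]_n.+1).

Definition height p : R := hyp_vec p 0 0.
Definition coords p : 'rV[R]_n := \row_i hyp_vec p 0 (lift ord0 i).

(** The hyperbolic cosine of the distance, polynomial in the coordinates. *)
Definition cosh_dist p q : R := - lorentz_form (hyp_vec p) (hyp_vec q).

Lemma hyp_vec_inj : injective (@hyp_vec R n).
Proof. by move=> p q; exact: (@val_inj _ _ (set_type (@hyperboloid R n))). Qed.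

Lemma hyp_vecP p : hyperboloid (hyp_vec p).
Proof. exact: set_valP. Qed.

Lemma height_gt0 p : 0 < height p.
Proof. by have [] := hyp_vecP p. Qed.

Lemma sum_coords2 p : \sum_(i < n) coords p 0 i ^+ 2 = height p ^+ 2 - 1.
Proof.
have [h _] := hyp_vecP p; rewrite -h /lorentz_form /height expr2.
rewrite addrA subrr add0r; apply: eq_bigr => i _; rewrite mxE; ring.
Qed.

Lemma height_ge1 p : 1 <= height p.
Proof.
have : 0 <= height p ^+ 2 - 1.
  by rewrite -sum_coords2; apply: sumr_ge0 => i _; exact: sqr_ge0.
have := height_gt0 p; nra.
Qed.

Lemma cosh_distE p q :
  cosh_dist p q = height p * height q - \sum_(i < n) coords p 0 i * coords q 0 i.
Proof.
rewrite /cosh_dist /lorentz_form opprD opprK; congr (_ - _).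
by apply: eq_bigr => i _; rewrite !mxE.
Qed.

(** A Lagrange identity in which every term on the right is nonnegative. It gives
    at once the positivity of the distance and its comparison with heights. *)
Lemma cosh_dist_lagrange p q :
  2 * height p * height q * cosh_dist p q = height p ^+ 2 + height q ^+ 2 +
  \sum_(i < n) (height p * coords q 0 i - height q * coords p 0 i) ^+ 2.
Proof.
have -> : \sum_(i < n) (height p * coords q 0 i - height q * coords p 0 i) ^+ 2
  = height p ^+ 2 * \sum_(i < n) coords q 0 i ^+ 2
    - 2 * height p * height q * \sum_(i < n) coords p 0 i * coords q 0 i
    + height q ^+ 2 * \sum_(i < n) coords p 0 i ^+ 2.
  by rewrite !mulr_sumr -sumrB -big_split /=; apply: eq_bigr => i _; ring.
by rewrite !sum_coords2 cosh_distE; ring.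
Qed.

Lemma cosh_distC p q : cosh_dist p q = cosh_dist q p.
Proof. by rewrite /cosh_dist lorentz_formC. Qed.

Lemma cosh_distpp p : cosh_dist p p = 1.
Proof. by rewrite /cosh_dist; have [-> _] := hyp_vecP p; rewrite opprK. Qed.

(** Together with [cosh_dist_le], this plays the role of the triangle inequality:
    up to factors depending on p, [cosh_dist p q] is the height of q. *)
Lemma height_le_cosh_dist p q : height q <= 2 * height p * cosh_dist p q.
Proof.
have p0 := height_gt0 p; have q0 := height_gt0 q.
rewrite -(ler_pM2r q0); have := cosh_dist_lagrange p q.
set S := (X in _ = _ + X) => E.
have S0 : 0 <= S by apply: sumr_ge0 => i _; exact: sqr_ge0.
by have := sqr_ge0 (height p); nra.
Qed.

Lemma cosh_dist_gt0 p q : 0 < cosh_dist p q.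
Proof.
have := height_le_cosh_dist p q; have := height_gt0 q; have := height_gt0 p; nra.
Qed.

Lemma cosh_dist_le p q : cosh_dist p q <= 2 * height p * height q.
Proof.
have p0 := height_gt0 p; have q0 := height_gt0 q.
pose S := \sum_(i < n) (height p * coords q 0 i + height q * coords p 0 i) ^+ 2.
have S0 : 0 <= S by apply: sumr_ge0 => i _; exact: sqr_ge0.
have SE : S = height p ^+ 2 * (height q ^+ 2 - 1)
    + 2 * height p * height q * (height p * height q - cosh_dist p q)
    + height q ^+ 2 * (height p ^+ 2 - 1).
  rewrite -!sum_coords2 cosh_distE subKr /S !mulr_sumr -!big_split /=.
  by apply: eq_bigr => i _; ring.
have pq0 : 0 < height p * height q by exact: mulr_gt0.
rewrite -(ler_pM2l pq0); nra.
Qed.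

(** In the equality case of [cosh_dist_lagrange], p and q have the same height
    and proportional spacelike coordinates. *)
Lemma cosh_dist_gt1 p q : p <> q -> 1 < cosh_dist p q.
Proof.
move=> pq; rewrite ltNge; apply/negP => c1; apply: pq.
have p0 := height_gt0 p; have q0 := height_gt0 q.
have pq0 : 0 < height p * height q by exact: mulr_gt0.
have := cosh_dist_lagrange p q; set S := (X in _ = _ + X) => E.
have S0 : 0 <= S by apply: sumr_ge0 => i _; exact: sqr_ge0.
have hpq : height p = height q.
  apply/eqP; rewrite -subr_eq0 -sqrf_eq0; apply/eqP/le_anti.
  by rewrite sqr_ge0 andbT; nra.
have S00 : S = 0 by apply/le_anti; rewrite S0 andbT; nra.
apply: hyp_vec_inj; apply/rowP => i; case: (unliftP ord0 i) => [j ->|->//].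
have /(_ j isT)/eqP := psumr_eq0P (fun j _ => sqr_ge0 _) S00.
rewrite sqrf_eq0 hpq -mulrBr mulf_eq0 gt_eqF//= subr_eq0 => /eqP.
by rewrite !mxE.
Qed.

Lemma hyp_vec_continuous : continuous (@hyp_vec R n).
Proof. by move=> p; exact: (initial_continuous (f := set_val)). Qed.

Lemma height_continuous : continuous height.
Proof.
move=> p; apply: (continuous_at_comp (g := fun M : 'rV[R]_n.+1 => M 0 0)).
  exact: hyp_vec_continuous.
exact: coord_continuous.
Qed.

Lemma coords_continuous : continuous coords.
Proof.
move=> p; apply: continuous_mx_entries => i j.
apply: (@eq_continuous_at _ _ (fun y => hyp_vec y 0 (lift ord0 j))).
  by move=> y; rewrite mxE.
apply: (continuous_at_comp (g := fun M : 'rV[R]_n.+1 => M 0 (lift ord0 j))).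
  exact: hyp_vec_continuous.
exact: coord_continuous.
Qed.

Lemma continuous_hyp (X : topologicalType) (f : X -> hyp R n) x :
  continuous_at x (fun y => hyp_vec (f y)) -> continuous_at x f.
Proof. exact: continuous_set_type. Qed.

Lemma continuous_cosh_dist (X : topologicalType) (f g : X -> hyp R n) x :
  continuous_at x f -> continuous_at x g ->
  continuous_at x (fun y => cosh_dist (f y) (g y)).
Proof.
move=> fc gc;
apply: (@eq_continuous_at _ _ (fun y => height (f y) * height (g y) -
    \sum_(i < n) coords (f y) 0 i * coords (g y) 0 i)).
  by move=> y; rewrite cosh_distE.
apply: cvgB.
  by apply: cvgM; apply: (continuous_at_comp (g := height)) => //;
    exact: height_continuous.
apply: (continuous_sumR (f := fun i y => coords (f y) 0 i * coords (g y) 0 i)) => i.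
apply: cvgM.
- apply: (continuous_at_comp (g := fun p => coords p 0 i)) => // p.
  apply: (continuous_at_comp (g := fun M : 'rV[R]_n => M 0 i)).
    exact: coords_continuous.
  exact: coord_continuous.
- apply: (continuous_at_comp (g := fun p => coords p 0 i)) => // p.
  apply: (continuous_at_comp (g := fun M : 'rV[R]_n => M 0 i)).
    exact: coords_continuous.
  exact: coord_continuous.
Qed.

Definition lift_vec (v : 'rV[R]_n) : 'rV[R]_n.+1 :=
  \row_i if unlift ord0 i is Some j then v 0 j
         else Num.sqrt (1 + \sum_(j < n) v 0 j ^+ 2).

Lemma lift_vecP v : hyperboloid (lift_vec v).
Proof.
have S0 : 0 <= \sum_(j < n) v 0 j ^+ 2 by apply: sumr_ge0 => i _; exact: sqr_ge0.
rewrite /hyperboloid /= /lorentz_form !mxE unlift_none; split; last first.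
  by rewrite sqrtr_gt0 ltr_pwDl.
rewrite -expr2 sqr_sqrtr ?addr_ge0// opprD -addrA -[RHS]addr0; congr (_ + _).
rewrite addrC; apply/eqP; rewrite subr_eq0; apply/eqP.
by apply: eq_bigr => i _; rewrite !mxE liftK expr2.
Qed.

(** The hyperboloid is the graph of a function of the spacelike coordinates;
    this identifies H^n with a vector space, in which balls can be contracted. *)
Definition of_coords (v : 'rV[R]_n) : hyp R n := SigSub (mem_set (lift_vecP v)).

Lemma coordsK : cancel coords of_coords.
Proof.
move=> p; apply: hyp_vec_inj; apply/rowP => i; rewrite mxE.
case: unliftP => [j ->|->]; first by rewrite mxE.
by rewrite sum_coords2 subrKC sqrtr_sqr gtr0_norm ?height_gt0.
Qed.

Lemma of_coords_continuous : continuous of_coords.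
Proof.
move=> v; apply: continuous_hyp; apply: continuous_mx_entries => i j.
apply: (@eq_continuous_at _ _ (fun v : 'rV[R]_n => if unlift ord0 j is Some k then v 0 k
         else Num.sqrt (1 + \sum_(j < n) v 0 j ^+ 2))).
  by move=> y; rewrite mxE.
case: (unlift ord0 j) => [k|]; first exact: coord_continuous.
apply: (@continuous_at_comp _ _ _
  (fun v : 'rV[R]_n => 1 + \sum_(j < n) v 0 j ^+ 2) Num.sqrt); last first.
  exact: sqrt_continuous.
have c1 := @cst_continuous 'rV[R]_n R 1 v.
have c2 : continuous_at v (fun v : 'rV[R]_n => \sum_(j < n) v 0 j ^+ 2).
  apply: (continuous_sumR (f := fun j (v : 'rV[R]_n) => v 0 j ^+ 2)) => k.
  apply: (@continuous_at_comp _ _ _ (fun v : 'rV[R]_n => v 0 k) (fun x => x ^+ 2)).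
    exact: coord_continuous.
  exact: exprn_continuous.
exact: continuousD c1 c2.
Qed.

Lemma compact_norm_le (c : R) : compact [set v : 'rV[R]_n | `|v| <= c].
Proof.
apply: bounded_closed_compact.
  exists c; split; first exact: num_real.
  by move=> x cx v /= vc; apply: le_trans vc (ltW cx).
apply: (@closed_comp _ _ (fun v : 'rV[R]_n => `|v|) [set x | x <= c]).
  by move=> v _; exact: norm_continuous.
exact: closed_le.
Qed.

Lemma coord_le_height p i : `|coords p 0 i| <= height p.
Proof.
rewrite -ler_sqr ?nnegrE ?(ltW (height_gt0 p))// real_normK ?num_real//.
have : height p ^+ 2 - 1 <= height p ^+ 2 by rewrite gerBl.
apply: le_trans; rewrite -sum_coords2 (bigD1 i)//= lerDl.
by apply: sumr_ge0 => k _; exact: sqr_ge0.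
Qed.

Lemma norm_coords_le p : `|coords p| <= height p.
Proof.
rewrite [leLHS]/Num.norm /= mx_normrE; apply/bigmax_leP; split => [|[i j] _ /=].
  exact: ltW (height_gt0 p).
by rewrite (ord1 i) coord_le_height.
Qed.

Lemma compact_height_le (c : R) : compact [set p | height p <= c].
Proof.
have -> : [set p | height p <= c] =
    of_coords @` ([set v : 'rV[R]_n | `|v| <= c] `&` [set v | height (of_coords v) <= c]).
  apply/seteqP; split => [p /= pc|_ [v [_ vc] <-]//].
  exists (coords p); rewrite /= ?coordsK//; split => //.
  exact: le_trans (norm_coords_le p) pc.
apply: continuous_compact.
  by apply: continuous_subspaceT; exact: of_coords_continuous.
apply: compact_closedI; first exact: compact_norm_le.
apply: (@closed_comp _ _ (fun v : 'rV[R]_n => height (of_coords v)) [set x | x <= c]).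
  move=> v _; apply: continuous_at_comp; last exact: height_continuous.
  exact: of_coords_continuous.
exact: closed_le.
Qed.

(** The left side is the Lorentz norm of the difference of the two vectors, which
    the Euclidean norm of the spacelike part dominates. *)
Lemma cosh_dist_le_coords p q :
  2 * (cosh_dist p q - 1) <= \sum_(i < n) (coords p 0 i - coords q 0 i) ^+ 2.
Proof.
have -> : \sum_(i < n) (coords p 0 i - coords q 0 i) ^+ 2 =
  \sum_(i < n) coords p 0 i ^+ 2 - 2 * (\sum_(i < n) coords p 0 i * coords q 0 i)
    + \sum_(i < n) coords q 0 i ^+ 2.
  by rewrite !mulr_sumr -sumrB -big_split /=; apply: eq_bigr => i _; ring.
rewrite !sum_coords2 cosh_distE; have := sqr_ge0 (height p - height q); lra.
Qed.

(** The dummy value p makes the action total in A. *)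
Definition act A p : hyp R n :=
  if pselect (hyperboloid (hyp_vec p *m A)) is left h then SigSub (mem_set h)
  else p.

Lemma act_vec A p : hyp_isometry A -> hyp_vec (act A p) = hyp_vec p *m A.
Proof.
move=> [_ _ hA]; rewrite /act; case: pselect => // -[].
exact/hA/hyp_vecP.
Qed.

Lemma cosh_dist_act A p q : hyp_isometry A ->
  cosh_dist (act A p) (act A q) = cosh_dist p q.
Proof. by move=> iA; rewrite /cosh_dist !act_vec//; have [_ -> _] := iA. Qed.

Lemma act_continuous A : hyp_isometry A -> continuous (act A).
Proof.
move=> iA p; apply: continuous_hyp.
apply: continuous_mx_entries => i j.
apply: (@eq_continuous_at _ _ (fun y => \sum_k hyp_vec y i k * A k j)).
  by move=> y; rewrite act_vec// mxE.
apply: (continuous_sumR (f := fun k y => hyp_vec y i k * A k j)) => k.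
have c1 : continuous_at p (fun y => hyp_vec y i k).
  apply: (continuous_at_comp (g := fun M : 'rV[R]_n.+1 => M i k)).
    exact: hyp_vec_continuous.
  exact: coord_continuous.
exact: continuousM c1 (@cst_continuous (hyp R n) R (A k j) p).
Qed.

End hyperbolic_coordinates.

(** * Orbits and quotients of hyperbolic space *)

Lemma near_finite (T : Type) (I : choiceType) (F : set_system T) (D : set I)
    (Q : I -> T -> Prop) {FF : Filter F} : finite_set D ->
  (forall i, D i -> \forall x \near F, Q i x) ->
  \forall x \near F, forall i, D i -> Q i x.
Proof.
move=> /finite_fsetP[X ->] DQ; have := filter_bigI FF DQ.
by apply: filterS => x Hx i iX; exact: Hx.
Qed.

Section orbits.
Variables (R : realType) (n : nat) (G : isometry_group R n).
Implicit Types (p q : hyp R n) (A B : 'M[R]_n.+1).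

Lemma act_vecG A p : G A -> hyp_vec (act A p) = hyp_vec p *m A.
Proof. by move=> GA; rewrite act_vec//; exact: isometries_sub GA. Qed.

Lemma act_id p : act 1%:M p = p.
Proof. by apply: hyp_vec_inj; rewrite act_vecG ?mulmx1//; exact: isometries1. Qed.

Lemma actM A B p : G A -> G B -> act (A *m B) p = act B (act A p).
Proof.
move=> GA GB; apply: hyp_vec_inj.
by rewrite !act_vecG ?mulmxA//; exact: isometriesM.
Qed.

Lemma isometriesK A : G A -> A *m invmx A = 1%:M /\ invmx A *m A = 1%:M.
Proof. by move=> /isometries_sub[uA _ _]; rewrite mulmxV ?mulVmx. Qed.

Lemma actK A p : G A -> act (invmx A) (act A p) = p.
Proof.
by move=> GA; rewrite -actM ?(isometriesK GA).1 ?act_id//; exact: isometriesV.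
Qed.

Lemma cosh_dist_actG A p q : G A -> cosh_dist (act A p) (act A q) = cosh_dist p q.
Proof. by move=> GA; apply: cosh_dist_act; exact: isometries_sub GA. Qed.

Lemma hyp_projP p q : hyp_proj G p = hyp_proj G q <-> exists2 A, G A & q = act A p.
Proof.
rewrite /hyp_proj; split.
  move=> /eqmodP/asboolP[A GA qE]; exists A => //.
  by apply: hyp_vec_inj; rewrite act_vecG.
move=> [A GA ->]; apply/eqmodP/asboolP; exists A => //.
by rewrite act_vecG.
Qed.

Lemma hyp_proj_surj x : exists p, hyp_proj G p = x.
Proof. by exists (repr x); rewrite /hyp_proj reprK. Qed.

Lemma hyp_proj_open (W : set (hyp R n)) : open W -> open (hyp_proj G @` W).
Proof.
move=> oW; rewrite /open /= /quotient_open.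
have -> : \pi_(hyp_quotient G) @^-1` (hyp_proj G @` W) =
    \bigcup_(A in [set A | G A]) (act A @^-1` W).
  apply/seteqP; split => [p [q Wq /esym/hyp_projP[A GA qE]]|p [A GA /= Wp]].
    by exists A => //=; rewrite -qE.
  by exists (act A p) => //; apply/esym/hyp_projP; exists A.
apply: bigcup_open => A GA; apply: open_comp => // p _.
by apply: act_continuous; exact: isometries_sub GA.
Qed.

(** The images in the quotient of the sets of bounded height are an increasing
    open exhaustion, up to a change of bound. *)
Lemma cocompact_height : compact [set: hyp_quotient G] ->
  exists c : R, forall p, exists2 A, G A & height (act A p) <= c.
Proof.
move=> /compact_near_coveringP cpt.
have /cpt : forall x, [set: hyp_quotient G] x -> \forall x' \near x & c \near +oo%R,
    (fun c x => exists2 p, hyp_proj G p = x & height p <= c) c x'.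
  move=> x _; have [p px] := hyp_proj_surj x.
  have nU : nbhs x (hyp_proj G @` [set q | height q < height p + 1]).
    apply: open_nbhs_nbhs; split; last by exists p => //=; rewrite ltrDl.
    apply: hyp_proj_open; apply: (@open_comp _ _ (@height R n) [set x | x < height p + 1]).
      by move=> q _; exact: height_continuous.
    exact: open_lt.
  exists (hyp_proj G @` [set q | height q < height p + 1], [set c | height p + 1 <= c]).
    by split => //=; exact: nbhs_pinfty_ge (num_real _).
  move=> [x' c] /= [[q qh qx'] pc]; exists q => //; exact: le_trans (ltW qh) pc.
move=> H; have [c cH] := filter_ex H.
exists c => p; have [q /esym/hyp_projP[A GA ->] qc] := cH (hyp_proj G p) I.
by exists A.
Qed.

Hypotheses (free : free_action G) (pd : properly_discontinuous G).

Lemma act_eq1 A p : G A -> act A p = p -> A = 1%:M.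
Proof. by move=> GA Ap; apply: (free (p := p)) => //; rewrite -act_vecG// Ap. Qed.

Lemma finite_height_return (c : R) :
  finite_set [set A | G A /\ exists p, height p <= c /\ height (act A p) <= c].
Proof.
apply: sub_finite_set (pd (compact_height_le (n := n) (c := c))).
move=> A /= [GA [p [pc Apc]]]; split => //; exists p, (act A p); split => //.
exact: act_vecG.
Qed.

(** q lies in the open Dirichlet domain of p. Since elements of G are isometries,
    this relation is symmetric and G-invariant, and two points of an orbit cannot
    both be strictly closest to p. *)
Definition dirichlet_near p q : Prop :=
  forall A, G A -> A <> 1%:M -> cosh_dist p q < cosh_dist p (act A q).

(** By proper discontinuity all but finitely many A send points close to q so high
    that they are farther from p than q is; each of the remaining finitely many
    inequalities is an open condition. *)
Lemma dirichlet_near_open p q : dirichlet_near p q ->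
  \forall x \near (p, q), dirichlet_near x.1 x.2.
Proof.
move=> pq; pose a := height p + 1; pose c := cosh_dist p q + 1.
pose X := (hyp R n * hyp R n)%type.
have c1 : continuous_at (p, q) (fun x : X => x.1) by exact: cvg_fst.
have c2 : continuous_at (p, q) (fun x : X => x.2) by exact: cvg_snd.
have h1 := continuous_at_comp c1 (@height_continuous R n).
have h2 := continuous_at_comp c2 (@height_continuous R n).
have h12 := continuous_cosh_dist c1 c2.
pose b := Num.max (height q + 1) (2 * a * c).
pose D := [set A | G A /\ exists p, height p <= b /\ height (act A p) <= b].
have fin : finite_set D := finite_height_return b.
have na : \forall x \near (p, q), height x.1 < a.
  by apply: (continuous_at_lt h1); rewrite ltrDl.
have nb : \forall x \near (p, q), height x.2 < height q + 1.
  by apply: (continuous_at_lt h2); rewrite ltrDl.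
have nc : \forall x \near (p, q), cosh_dist x.1 x.2 < c.
  by apply: (continuous_at_lt h12); rewrite ltrDl.
have nF : \forall x \near (p, q), forall A, D A -> A <> 1%:M ->
    cosh_dist x.1 x.2 < cosh_dist x.1 (act A x.2).
  apply: (near_finite (F := nbhs (p, q)) (Q := fun A (x : X) => A <> 1%:M ->
    cosh_dist x.1 x.2 < cosh_dist x.1 (act A x.2)) fin) => A [GA _].
  have [->|A1] := pselect (A = 1%:M).
    by near=> x.
  have := pq A GA A1; rewrite -subr_gt0 => pqA.
  have actc := act_continuous (isometries_sub GA).
  have cA := continuous_cosh_dist c1 (continuous_at_comp c2 actc).
  have {}cA := continuousB cA h12.
  have : \forall x \near (p, q), 0 < cosh_dist x.1 (act A x.2) - cosh_dist x.1 x.2.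
    exact: (continuous_at_gt cA).
  by apply: filterS => x; rewrite subr_gt0.
near=> x => A GA A1.
have xa : height x.1 < a by near: x.
have xb : height x.2 < height q + 1 by near: x.
have xc : cosh_dist x.1 x.2 < c by near: x.
have xF : forall A, D A -> A <> 1%:M ->
  cosh_dist x.1 x.2 < cosh_dist x.1 (act A x.2) by near: x.
have [hA|hA] := leP (height (act A x.2)) b.
  by apply: xF => //; split => //; exists x.2; rewrite hA le_max (ltW xb).
apply: (lt_trans xc).
have : 2 * a * c < height (act A x.2) by apply: le_lt_trans hA; rewrite le_max lexx orbT.
have := height_le_cosh_dist x.1 (act A x.2).
have := cosh_dist_gt0 x.1 (act A x.2); have := height_gt0 x.1.
have : 0 < a by rewrite addr_gt0 ?height_gt0.
nra.
Unshelve. all: by end_near. Qed.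

Lemma dirichlet_nearness_cover : nearness_cover (hyp_proj G) dirichlet_near.
Proof.
split.
- exact: hyp_proj_surj.
- exact: hyp_proj_open.
- exact: dirichlet_near_open.
- move=> p A GA A1; rewrite cosh_distpp; apply: cosh_dist_gt1 => pA.
  by apply: A1; apply: (act_eq1 (p := p)).
- move=> p q pq A GA A1; have GV := isometriesV GA.
  have -> : cosh_dist q (act A p) = cosh_dist p (act (invmx A) q).
    by rewrite cosh_distC -(cosh_dist_actG _ _ GV) actK.
  rewrite cosh_distC.
  apply: pq => // V1; apply: A1.
  by have [+ _] := isometriesK GA; rewrite V1 mulmx1.
- move=> p q1 q2 pq1 pq2 /hyp_projP[A GA qE]; have [A1|A1] := pselect (A = 1%:M).
    by rewrite qE A1 act_id.
  have V1 : invmx A <> 1%:M.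
    by move=> V1; apply: A1; have [+ _] := isometriesK GA; rewrite V1 mulmx1.
  have := pq1 A GA A1; rewrite -qE => /lt_trans /(_ (pq2 _ (isometriesV GA) V1)).
  by rewrite qE actK// ltxx.
- move=> p q /hyp_projP[A GA qE]; exists (act A); split=> //.
    by move=> x; apply/esym/hyp_projP; exists A.
  move=> x y xy D GD D1; have GV := isometriesV GA.
  have GC : G (A *m D *m invmx A) by apply: isometriesM => //; exact: isometriesM.
  have -> : act D (act A y) = act A (act (A *m D *m invmx A) y).
    rewrite -actM// -[RHS]actM//; congr (act _ y).
    by rewrite -mulmxA (isometriesK GA).2 mulmx1.
  rewrite !cosh_dist_actG//; apply: xy => // C1; apply: D1.
  have: invmx A *m (A *m D *m invmx A) *m A = 1%:M.
    by rewrite C1 mulmx1 (isometriesK GA).2.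
  rewrite -!mulmxA (isometriesK GA).2 mulmx1 mulmxA (isometriesK GA).2.
  by rewrite mul1mx.
Qed.

End orbits.

(** * The infinite cyclic cover of a mapping torus *)

Section infinite_cyclic_cover.
Variables (R : realType) (S : topologicalType) (f : homeomorphism S S).
Implicit Types (x y : S) (m n : int).

Definition iterz m x : S :=
  match m with
  | Posz k => iter k f x
  | Negz k => iter k.+1 (homeo_inv f) x
  end.

Lemma iterz_succ m x : iterz (m + 1) x = f (iterz m x).
Proof.
case: m => [k|[|k]].
- by rewrite -PoszD addn1.
- by rewrite /= homeo_invK.
- have -> : Negz k.+1 + 1 = Negz k by rewrite !NegzE -[k.+2]addn1 PoszD opprD subrK.
  by rewrite /= homeo_invK.
Qed.

Lemma iterz_pred m x : iterz (m - 1) x = homeo_inv f (iterz m x).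
Proof. by rewrite -[in RHS](subrK 1 m) iterz_succ homeo_funK. Qed.

Lemma iterzD m n x : iterz (m + n) x = iterz m (iterz n x).
Proof.
elim/int_ind: m => [|k IH|k IH]; first by rewrite add0r.
- by rewrite -addn1 PoszD addrAC !iterz_succ IH.
- by rewrite -addn1 PoszD opprD addrAC !iterz_pred IH.
Qed.

Lemma iterz_continuous m : continuous (iterz m).
Proof.
have it (g : S -> S) k : continuous g -> continuous (iter k g).
  move=> gc; elim: k => [|k IH] x; first exact: cvg_id.
  exact: continuous_at_comp (IH x) gc.
case: m => k; apply: it; [exact: homeo_continuous|exact: homeo_inv_continuous].
Qed.

Lemma frac_subproof (r : R) :
  r - (Num.floor r)%:~R \in (`[0, 1]%classic : set R).
Proof.
rewrite inE /= in_itv /= subr_ge0 floor_le /=.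
by rewrite lerBlDl -[1]/(1%:~R) -intrD ltW// floorD1_gt.
Qed.

Definition frac (r : R) : unit_interval R := SigSub (frac_subproof r).

Definition torus_proj (x : S) (s : unit_interval R) : mapping_torus R f :=
  \pi_(mapping_torus R f) (x, s).

(** The cover of the mapping torus by S x R with deck transformation
    (x, t) |-> (f x, t - 1). *)
Definition cyclic_cover (z : S * R) : mapping_torus R f :=
  torus_proj (iterz (Num.floor z.2) z.1) (frac z.2).

Lemma interval_valP (s : unit_interval R) : 0 <= interval_val s <= 1.
Proof. by have := set_valP s; rewrite /= in_itv. Qed.

Lemma interval_val_inj : injective (@interval_val R).
Proof.
by move=> s t; exact: (@val_inj _ _ (set_type (`[0, 1]%classic : set R))).
Qed.

Lemma iterzNK m : cancel (iterz m) (iterz (- m)).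
Proof. by move=> x; rewrite -iterzD addNr. Qed.

Lemma iterzKN m : cancel (iterz (- m)) (iterz m).
Proof. by move=> x; rewrite -iterzD subrr. Qed.

(** The fibres in a form symmetric in all sheets: integral parts disappear, and
    so does the discontinuity of the floor function at the integers. *)
Lemma cyclic_coverP y (r : R) x (s : unit_interval R) :
  cyclic_cover (y, r) = torus_proj x s <->
  exists m, y = iterz (- m) x /\ r = interval_val s + m%:~R.
Proof.
pose m := Num.floor r.
have fracE : interval_val (frac r) = r - m%:~R by [].
have r1 : r - m%:~R < 1.
  by rewrite ltrBlDl -[1]/(1%:~R) -intrD floorD1_gt.
split.
  rewrite /cyclic_cover /torus_proj /=.
  move=> /eqmodP/asboolP[[<- <-]|[/= rm1 _ _]|[/= rm0 s1 yE]].
  - by exists m; rewrite iterzNK fracE subrK.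
  - by move: r1; rewrite -fracE rm1 ltxx.
  - exists (m - 1); split.
      by rewrite opprB addrC iterzD -[iterz 1 x]/(f x) -yE iterzNK.
    by rewrite s1 rmorphB /= addrC subrK; apply/eqP; rewrite -subr_eq0 -fracE rm0.
move=> [k [-> rE]]; have /andP[s0 s1] := interval_valP s.
rewrite /cyclic_cover /torus_proj /=; apply/eqmodP/asboolP.
have [s_lt1|s_ge1] := ltP (interval_val s) 1.
  have mk : m = k.
    by apply: floor_def; rewrite rE intrD; lra.
  apply: Or31; rewrite -/m mk iterzKN; congr (_, _).
  by apply: interval_val_inj; rewrite fracE mk rE addrK.
have {s_ge1 s1}s1 : interval_val s = 1 by apply/le_anti; rewrite s1.
have mk : m = k + 1.
  by apply: floor_def; rewrite rE s1 !intrD; lra.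
apply: Or33; split=> //=; first by rewrite fracE mk rE s1 intrD; lra.
by rewrite -/m mk iterz_succ iterzKN.
Qed.

Lemma cyclic_cover_surj z : exists e, cyclic_cover e = z.
Proof.
case E : (repr z) => [x s]; exists (x, interval_val s).
rewrite -[z]reprK E; apply/cyclic_coverP; exists 0.
by rewrite oppr0 addr0.
Qed.

Lemma cyclic_cover_open (W : set (S * R)) : open W -> open (cyclic_cover @` W).
Proof.
move=> oW; rewrite /open /= /quotient_open.
pose shift m (z : S * unit_interval R) : S * R :=
  (iterz (- m) z.1, interval_val z.2 + m%:~R).
have -> : \pi_(mapping_torus R f) @^-1` (cyclic_cover @` W) =
    \bigcup_(m in [set: int]) (shift m @^-1` W).
  apply/seteqP; split => [[x s] [[y r] Wyr /cyclic_coverP[m [yE rE]]]|[x s] [m _ /= Wm]].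
    by exists m => //=; rewrite /shift /= -yE -rE.
  by exists (shift m (x, s)) => //; apply/cyclic_coverP; exists m.
apply: bigcup_open => m _; apply: open_comp => // z _.
apply: continuous_at_pair => /=.
  apply: (@continuous_at_comp (S * unit_interval R)%type S S fst); first exact: cvg_fst.
  exact: iterz_continuous.
have c1 : continuous_at z (fun z : S * unit_interval R => interval_val z.2).
  apply: (@continuous_at_comp _ _ _ snd); first exact: cvg_snd.
  by move=> s; exact: (initial_continuous (f := set_val)).
exact: continuousD c1 (@cst_continuous (S * unit_interval R)%type R m%:~R z).
Qed.

Definition param_near (z w : S * R) : Prop := `|z.2 - w.2| < 2^-1.

(** Points of a fibre have parameters that differ by integers, so half a unit is
    a possible scale of nearness, whatever the monodromy. *)
Lemma cyclic_nearness_cover : nearness_cover cyclic_cover param_near.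
Proof.
split.
- exact: cyclic_cover_surj.
- exact: cyclic_cover_open.
- move=> e e' ee'; pose X := ((S * R) * (S * R))%type.
  have c1 : continuous_at (e, e') (fun z : X => z.1.2).
    apply: (@continuous_at_comp X (S * R)%type R fst snd); first exact: cvg_fst.
    by move=> z; exact: cvg_snd.
  have c2 : continuous_at (e, e') (fun z : X => z.2.2).
    apply: (@continuous_at_comp X (S * R)%type R snd snd); first exact: cvg_snd.
    by move=> z; exact: cvg_snd.
  have c3 := continuous_at_comp (continuousB c1 c2) (@norm_continuous _ R).
  exact: (continuous_at_lt c3).
- by move=> e; rewrite /param_near subrr normr0 invr_gt0.
- by move=> e e'; rewrite /param_near distrC.
- move=> [y r] [y1 r1] [y2 r2]; rewrite /param_near /= => n1 n2.
  case E : (repr (cyclic_cover (y1, r1))) => [x s] yy.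
  have E1 : cyclic_cover (y1, r1) = torus_proj x s by rewrite /torus_proj -E reprK.
  have E2 : cyclic_cover (y2, r2) = torus_proj x s by rewrite -yy.
  move: E1 E2 => /cyclic_coverP[m1 [-> r1E]] /cyclic_coverP[m2 [-> r2E]].
  suff mm : m1 = m2 by rewrite r1E r2E mm.
  have : `|r1 - r2| < 1.
    apply: le_lt_trans (ler_distD r r1 r2) _; rewrite [`|r1 - r|]distrC.
    by apply: lt_le_trans (ltrD n1 n2) _; lra.
  rewrite r1E r2E opprD addrACA subrr add0r -rmorphB /=.
  rewrite -intr_norm -[1]/(1%:~R) ltr_int => mm.
  by apply/eqP; rewrite -subr_eq0 -normr_eq0; lia.
- move=> [y1 r1] [y2 r2] yy.
  case E : (repr (cyclic_cover (y1, r1))) => [x s].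
  have E1 : cyclic_cover (y1, r1) = torus_proj x s by rewrite /torus_proj -E reprK.
  have E2 : cyclic_cover (y2, r2) = torus_proj x s by rewrite -yy.
  move: E1 E2 => /cyclic_coverP[m1 [y1E r1E]] /cyclic_coverP[m2 [y2E r2E]].
  pose k : int := m1 - m2.
  exists (fun z => (iterz k z.1, z.2 - k%:~R)); split.
  + congr (_, _) => /=; first by rewrite y1E y2E -iterzD /k addrAC subrr add0r.
    by rewrite r1E r2E /k intrB; ring.
  + move=> [u t]; case E' : (repr (cyclic_cover (u, t))) => [x' s'].
    have E1 : cyclic_cover (u, t) = torus_proj x' s' by rewrite /torus_proj -E' reprK.
    rewrite E1; move: E1 => /cyclic_coverP[m [-> ->]]; apply/cyclic_coverP.
    exists (m - k); split => /=; first by rewrite opprB [RHS]iterzD.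
    by rewrite intrB; ring.
  + by move=> [u t] [u' t']; rewrite /param_near /= opprB addrA subrK.
Qed.

End infinite_cyclic_cover.

(** * Incompressibility of the fibre *)

Section fibre_injective.
Variables (R : realType) (G : isometry_group R 2) (L : isometry_group R 3).
Variables (f : homeomorphism (hyp_quotient G) (hyp_quotient G)).
Variables (h : homeomorphism (mapping_torus R f) (hyp_quotient L)).
Variable iota : hyp R 2 -> hyp R 3.

(** Join p to q by a path alpha and let Q be the projection of H^3, centred at
    iota p, to the mapping torus. Lifting Q on a large ball to S x R, and the
    first component of this lift to H^2, yields a map g2 with g2 (iota (alpha s))
    = alpha s for all s, by uniqueness of lifts. As iota p = iota q, the two ends
    of alpha coincide. *)
Lemma fibre_lift_injective : free_action G -> properly_discontinuous G ->
  fibre_lift h iota -> injective iota.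
Proof.
move=> free pd [iotac iotaE _] p q pq.
pose alpha (s : R) := of_coords ((1 - s) *: coords p + s *: coords q).
have alpha0 : alpha 0 = p by rewrite /alpha subr0 scale1r scale0r addr0 coordsK.
have alpha1 : alpha 1 = q by rewrite /alpha subrr scale1r scale0r add0r coordsK.
have alphac : continuous alpha.
  move=> s; apply: (continuous_at_comp (g := @of_coords R 2)); last first.
    exact: of_coords_continuous.
  have c1 : continuous_at s (fun s : R => (1 - s) *: coords p).
    apply: (@continuous_at_comp _ _ _ (fun s : R => 1 - s) (fun s => s *: coords p)).
      exact: continuousB (@cst_continuous R R 1 s) (@cvg_id _ (nbhs s)).
    exact: scalel_continuous.
  have c2 : continuous_at s (fun s : R => s *: coords q).
    exact: scalel_continuous.
  exact: continuousD c1 c2.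
pose x0 := coords (iota p).
pose beta s : 'rV[R]_3 := coords (iota (alpha s)) - x0.
have betac : continuous beta.
  move=> s.
  have c1 := continuous_at_comp
    (continuous_at_comp (@alphac s) iotac) (@coords_continuous R 3).
  exact: continuousB c1 (@cst_continuous R 'rV[R]_3 x0 s).
have beta0 : beta 0 = 0 by rewrite /beta alpha0 subrr.
have beta1 : beta 1 = 0 by rewrite /beta alpha1 -pq subrr.
have [r rP] : exists r : R, forall s, s \in `[0, 1]%R -> `|beta s| < r.
  have nc : continuous (fun s => `|beta s|).
    by move=> s; apply: (continuous_at_comp (@betac s)); exact: norm_continuous.
  have [c _ cP] := EVT_max ler01 (continuous_subspaceT nc).
  by exists (`|beta c| + 1) => s /cP sc; apply: le_lt_trans sc _; rewrite ltrDl.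
pose Q (v : 'rV[R]_3) := homeo_inv h (hyp_proj L (of_coords (x0 + v))).
have Qc : continuous Q.
  move=> v; apply: (continuous_at_comp (g := homeo_inv h)); last first.
    exact: homeo_inv_continuous.
  apply: (continuous_at_comp (g := hyp_proj L)); last exact: pi_continuous.
  apply: (continuous_at_comp (g := @of_coords R 3)); last exact: of_coords_continuous.
  exact: continuousD (@cst_continuous 'rV[R]_3 'rV[R]_3 x0 v) (@cvg_id _ (nbhs v)).
have Qbeta s : Q (beta s) = cyclic_cover f (hyp_proj G (alpha s), 0).
  rewrite /Q /beta addrC subrK coordsK iotaE homeo_funK; apply/esym/cyclic_coverP.
  by exists 0; rewrite oppr0 addr0.
have Q0 : cyclic_cover f (hyp_proj G p, 0) = Q 0 by rewrite -beta0 Qbeta alpha0.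
have [g1 [g10 g1c g1P]] := cover_lift (cyclic_nearness_cover R f)
  (@compact_norm_le R 3 (r + 1)) (fun x _ => Qc x) Q0.
have c1r x : `|x| <= r -> {for x, continuous (fun x => (g1 x).1)}.
  move=> xr; apply: (@continuous_at_comp _ _ _ g1 fst); last by move=> z; exact: cvg_fst.
  by apply: g1c; apply: le_lt_trans xr _; rewrite ltrDl.
have p0 : hyp_proj G p = (g1 0).1 by rewrite g10.
have [g2 [g20 g2c g2P]] := cover_lift (dirichlet_nearness_cover free pd)
  (@compact_norm_le R 3 r) c1r p0.
have u1 : {in `[0, 1]%R,
    (fun s => g1 (beta s)) =1 (fun s => (hyp_proj G (alpha s), 0))}.
  apply: (cover_lift_unique (cyclic_nearness_cover R f)).
  - move=> s /rP sr; apply: (@continuous_comp _ _ _ beta g1); first exact: betac.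
    by apply: g1c; apply: lt_trans sr _; rewrite ltrDl.
  - move=> s _; apply: continuous_at_pair; last exact: cst_continuous.
    apply: (continuous_at_comp (g := hyp_proj G)); last exact: pi_continuous.
    exact: alphac.
  - by move=> s /rP sr; rewrite g1P ?Qbeta// (lt_trans sr)// ltrDl.
  - by rewrite beta0 alpha0.
have u2 : {in `[0, 1]%R, (fun s => g2 (beta s)) =1 alpha}.
  apply: (cover_lift_unique (dirichlet_nearness_cover free pd)).
  - move=> s /rP sr; apply: (@continuous_comp _ _ _ beta g2); first exact: betac.
    exact: g2c.
  - by move=> s _; exact: alphac.
  - by move=> s s01; rewrite g2P ?u1//; exact: rP.
  - by rewrite beta0 alpha0.
have /u2 : (1 : R) \in `[0, 1]%R by rewrite in_itv /= ler01 lexx.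
by rewrite beta1 g20 alpha1.
Qed.

End fibre_injective.

(** * Counting orbit points in Euclidean cubes *)

Section orbit_separation.
Variables (R : realType) (n : nat) (L : isometry_group R n).
Hypotheses (free : free_action L) (pd : properly_discontinuous L).

(** Only finitely many elements move y by a bounded amount, and none fixes it. *)
Lemma orbit_gap (y : hyp R n) : exists2 e : R, 0 < e &
  forall B, L B -> B <> 1%:M -> 1 + e <= cosh_dist y (act B y).
Proof.
pose b := Num.max (height y) (4 * height y).
pose D := [set A | L A /\ exists p, height p <= b /\ height (act A p) <= b].
have fin : finite_set D := finite_height_return pd b.
have H : \forall e \near (0 : R)^'+, forall A, D A -> A <> 1%:M ->
    1 + e <= cosh_dist y (act A y).
  apply: (near_finite (Q := fun A e => A <> 1%:M -> 1 + e <= cosh_dist y (act A y)) fin).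
  move=> A [LA _]; have [->|A1] := pselect (A = 1%:M); first by near=> e.
  have : 1 < cosh_dist y (act A y).
    by apply: cosh_dist_gt1 => yA; apply: A1; apply: (act_eq1 free (p := y)).
  rewrite -subr_gt0 => /(@nbhs_right_le R 0); apply: filterS => e.
  by rewrite lerBrDl.
have [e [[eH e1] e0]] := filter_ex
  (filterI (filterI H (@nbhs_right_le R 0 1 ltr01)) (@nbhs_right_gt R 0)).
exists e => // B LB B1; have [hB|hB] := leP (height (act B y)) b.
  by apply: eH => //; split=> //; exists y; split => //; rewrite /b le_max lexx.
have : 4 * height y < height (act B y) by apply: le_lt_trans hB; rewrite le_max lexx orbT.
have := height_le_cosh_dist y (act B y); have := height_gt0 y.
move: e1; rewrite /=; nra.
Unshelve. all: by end_near. Qed.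

(** The gap of the orbit, transported by isometries to any of its points, bounds
    from below the Euclidean distance of coordinates by [cosh_dist_le_coords]. *)
Lemma orbit_separated (y : hyp R n) : exists2 s : R, 0 < s &
  forall B1 B2, L B1 -> L B2 ->
    (forall i, `|coords (act B1 y) 0 i - coords (act B2 y) 0 i| < s) ->
    act B1 y = act B2 y.
Proof.
have [e e0 eP] := orbit_gap y.
pose s := Num.min 1 (2 * e / n.+1%:R).
have n0 : 0 < n.+1%:R :> R by rewrite ltr0n.
have s0 : 0 < s by rewrite lt_min ltr01 divr_gt0// mulr_gt0.
exists s => // B1 B2 L1 L2 close.
pose B := B2 *m invmx B1.
have LB : L B by apply: isometriesM => //; exact: isometriesV.
have B2E : act B2 y = act B1 (act B y).
  rewrite -(actM _ LB L1); congr (act _ y).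
  by rewrite /B -mulmxA (isometriesK L1).2 mulmx1.
have [BE|BE] := pselect (B = 1%:M); first by rewrite B2E BE act_id.
have := eP B LB BE; rewrite -(cosh_dist_actG _ _ L1) -B2E.
have := cosh_dist_le_coords (act B1 y) (act B2 y).
set S := \sum_(i < n) _; set C := cosh_dist _ _ => CS eC.
have : S <= n%:R * s.
  rewrite -[n in n%:R]card_ord -sum1_card natr_sum mulr_suml; apply: ler_sum => i _.
  rewrite mul1r -real_normK ?num_real//; apply: (@le_trans _ _ (s ^+ 2)).
    by rewrite ler_sqr ?nnegrE ?(ltW s0)// ltW.
  by rewrite expr2 ler_piMl ?(ltW s0)// ge_min lexx.
have : n%:R * s < n.+1%:R * s by rewrite ltr_pM2r// ltr_nat.
have : n.+1%:R * s <= 2 * e by rewrite mulrC -ler_pdivlMr// ge_min lexx orbT.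
by move=> *; exfalso; clear B2E; lra.
Qed.

End orbit_separation.

(** The index of the cube of side s that contains v, among the cubes subdividing
    the cube of centre 0 and half-side Z; [inord] is exact only when m is at
    least the integral part of 2 Z / s. *)
Definition grid_cell (R : realType) n (Z s : R) (m : nat) (v : 'rV[R]_n) :
  {ffun 'I_n -> 'I_m.+1} :=
  [ffun i => inord (Num.truncn ((v 0 i + Z) / s))].

Lemma grid_cellP (R : realType) n (Z s : R) (v w : 'rV[R]_n) i :
  0 < s -> `|v 0 i| <= Z -> `|w 0 i| <= Z ->
  grid_cell Z s (Num.truncn (2 * Z / s)) v = grid_cell Z s (Num.truncn (2 * Z / s)) w ->
  `|v 0 i - w 0 i| < s.
Proof.
move=> s0 vZ wZ /ffunP/(_ i); rewrite !ffunE => /(congr1 val) /=.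
have bnd (u : R) : `|u| <= Z -> 0 <= (u + Z) / s /\ (u + Z) / s <= 2 * Z / s.
  rewrite ler_norml => /andP[u1 u2]; split.
    by rewrite divr_ge0 ?(ltW s0)//; lra.
  by rewrite ler_pM2r ?invr_gt0//; lra.
have [v0 v1] := bnd _ vZ; have [w0 w1] := bnd _ wZ.
rewrite !inordK ?ltnS ?le_truncn// => E.
have /andP[a1 a2] := truncn_itv v0; have /andP[b1 b2] := truncn_itv w0.
rewrite -[s in X in _ < X]mul1r -ltr_pdivrMr// -[s^-1]gtr0_norm ?invr_gt0// -normrM.
have -> : (v 0 i - w 0 i) / s = (v 0 i + Z) / s - (w 0 i + Z) / s by ring.
by rewrite ltr_norml; move: a1 a2 b1 b2; rewrite E -!natr1; lra.
Qed.

(** From 1 - cos x = 2 sin(x/2)^2 and sin y >= (cos 1/2) y on [0, 1/2]. *)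
Lemma quadratic_le_one_sub_cos (R : realType) : exists2 c : R, 0 < c &
  forall x : R, `|x| <= 1 -> c * x ^+ 2 <= 1 - cos x.
Proof.
pose c0 := cos (2^-1 : R).
have pi2 : 2 <= pi :> R := pi_ge2 R.
have c0_gt0 : 0 < c0 by apply: cos_gt0_pihalf; lra.
exists (c0 ^+ 2 / 2); first by rewrite divr_gt0// exprn_gt0.
have half (x : R) : 0 <= x <= 1 -> c0 ^+ 2 / 2 * x ^+ 2 <= 1 - cos x.
  move=> /andP[x0 x1]; have -> : x = (x / 2) *+ 2 by rewrite mulr2n; lra.
  rewrite cos_mulr2n cos2sin2; set y := x / 2.
  have [y0 y1] : 0 <= y /\ y <= 2^-1 by rewrite /y; lra.
  have : c0 * y <= sin y.
    have [z] := MVT_segment y0 (fun x _ => is_derive_sin x)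
      (continuous_subspaceT (@continuous_sin R)).
    rewrite in_itv /= sin0 !subr0 => /andP[z0 zy] ->; rewrite ler_wpM2r//.
    by rewrite leNgt ltr_cos ?in_itv/= -?leNgt; lra.
  have := mulr_ge0 (ltW c0_gt0) y0; nra.
move=> x; rewrite ler_norml => /andP[x1 x2].
have [x0|x0] := leP 0 x; first by apply: half; rewrite x0.
by rewrite -cosN -[x ^+ 2]sqrrN; apply: half; rewrite oppr_ge0 ltW//= lerNl.
Qed.

(** * Divergence of geodesic rays *)

Section rays.
Variables (R : realType).

Definition ray n (w : uthyp R n) (T : R) : hyp R n := base_point (geodesic_flow T w).

Lemma ray_vec n (w : uthyp R n) (T : R) :
  hyp_vec (ray w T) = cosh T *: (uthyp_vec w).1 + sinh T *: (uthyp_vec w).2.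
Proof. by rewrite /ray base_pointE. Qed.

Lemma lorentz_form_combine n (x a b : 'rV[R]_n.+1) (t u c s t' u' c' s' : R) :
  lorentz_form x x = -1 -> lorentz_form a a = 1 -> lorentz_form b b = 1 ->
  lorentz_form x a = 0 -> lorentz_form x b = 0 -> lorentz_form a b = 0 ->
  lorentz_form (t *: x + u *: (c *: a + s *: b))
               (t' *: x + u' *: (c' *: a + s' *: b)) =
  - (t * t') + u * u' * (c * c' + s * s').
Proof.
move=> xx aa bb xa xb ab.
have ax := etrans (lorentz_formC a x) xa.
have bx := etrans (lorentz_formC b x) xb.
have ba := etrans (lorentz_formC b a) ab.
rewrite !lorentz_form_lin.
rewrite !(lorentz_formC x (_ + _)) !(lorentz_formC a (_ + _)).
rewrite !(lorentz_formC b (_ + _)).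
by rewrite !lorentz_form_lin xx aa bb xa xb ab ax bx ba; ring.
Qed.

(** The hyperbolic law of cosines, for rays issued from a common point. *)
Lemma polar_ray_dist (r phi theta theta' T T' : R) :
  cosh_dist (ray (ut_polar (r, phi, theta)) T) (ray (ut_polar (r, phi, theta')) T') =
  cosh T * cosh T' - sinh T * sinh T' * cos (theta - theta').
Proof.
rewrite /cosh_dist !ray_vec /=.
have h := cosh2B r; have h1 := cos2Dsin2 phi.
have hs : sinh r ^+ 2 = cosh r ^+ 2 - 1 by rewrite -h; ring.
have s1 : sin phi ^+ 2 = 1 - cos phi ^+ 2 by rewrite -h1; ring.
rewrite lorentz_form_combine.
- by rewrite cosB; ring.
- rewrite lorentz_form_row3; ring: hs s1.
- rewrite lorentz_form_row3; ring: hs s1.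
- rewrite lorentz_form_row3; ring: hs s1.
- rewrite lorentz_form_row3; ring: hs s1.
- rewrite lorentz_form_row3; ring: hs s1.
- rewrite lorentz_form_row3; ring: hs s1.
Qed.

Lemma sinh_ge (T : R) : 1 <= T -> expR T / 4 <= sinh T.
Proof.
move=> T1; have e2 : 2 <= expR T by apply: le_trans (expR_ge1Dx T); lra.
have : expR (- T) <= 1 by rewrite -expR0 ler_expR; lra.
by rewrite /sinh; lra.
Qed.

Lemma sinh_le_cosh (T : R) : 0 <= T -> 0 <= sinh T /\ sinh T <= cosh T.
Proof.
move=> T0; have := expR_gt0 (- T); have : expR (- T) <= expR T by rewrite ler_expR; lra.
by rewrite /sinh /cosh; split; lra.
Qed.

(** Since cosh T cosh T' >= sinh T sinh T', the law of cosines bounds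
    sinh T sinh T' (1 - cos (theta - theta')) by M. *)
Lemma polar_angle_le (M : R) : exists2 c : R, 0 < c &
  forall r phi theta theta' t T T' : R,
  1 <= t -> t <= T -> t <= T' -> `|theta - theta'| <= 1 ->
  cosh_dist (ray (ut_polar (r, phi, theta)) T)
            (ray (ut_polar (r, phi, theta')) T') <= M ->
  `|theta - theta'| <= c * expR (- t).
Proof.
have [c c0 cP] := quadratic_le_one_sub_cos R.
(* Only K^2 >= 16 M / c matters; a bound K >= 1 dispenses with a square root. *)
pose K := 16 * (`|M| + 1) / c + 1.
have K0 : 0 <= 16 * (`|M| + 1) / c by rewrite divr_ge0 ?(ltW c0)// mulr_ge0// addr_ge0.
have K1 : 1 <= K by rewrite /K; lra.
have MK : 16 * M <= c * K.
  rewrite /K mulrDr mulrCA mulfV ?lt0r_neq0// !mulr1; have := ler_norm M; lra.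
exists K; first lra.
move=> r phi theta theta' t T T' t1 tT tT' x1; rewrite polar_ray_dist.
set x := theta - theta' in x1 *; have := cP _ x1 => {cP}.
have T_ge0 : 0 <= T by lra.
have T'_ge0 : 0 <= T' by lra.
have [sh0 sh1] := sinh_le_cosh T_ge0.
have [sh0' sh1'] := sinh_le_cosh T'_ge0.
have e0 := expR_gt0 t.
have eT : expR t / 4 <= sinh T.
  by apply: le_trans (sinh_ge _); [rewrite ler_pM2r ?ler_expR|lra].
have eT' : expR t / 4 <= sinh T'.
  by apply: le_trans (sinh_ge _); [rewrite ler_pM2r ?ler_expR|lra].
set e := expR t in e0 eT eT' *; set co := cos x.
move=> cx HM.
have h1 : sinh T * sinh T' <= cosh T * cosh T' by apply: ler_pM.
have h2 : e / 4 * (e / 4) <= sinh T * sinh T' by apply: ler_pM => //; lra.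
have h3 : sinh T * sinh T' * (1 - co) <= M by lra.
have x20 : 0 <= c * x ^+ 2 by rewrite mulr_ge0 ?(ltW c0)// sqr_ge0.
have h4 : e / 4 * (e / 4) * (c * x ^+ 2) <= M.
  apply: le_trans h3; apply: ler_pM => //; first by rewrite mulr_ge0//; lra.
have h5 : (e * `|x|) ^+ 2 <= K.
  rewrite exprMn real_normK ?num_real//; nra.
have h6 : e * `|x| <= K.
  have : 0 <= e * `|x| by rewrite mulr_ge0 ?(ltW e0).
  nra.
by rewrite expRN ler_pdivlMr// mulrC.
Qed.

End rays.

(** * Slow directions at a point *)

Section equivariant_map.
Variables (R : realType) (G : isometry_group R 2) (L : isometry_group R 3).
Variable iota : hyp R 2 -> hyp R 3.
Hypotheses (iota_cont : continuous iota) (iota_inj : injective iota).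
Hypothesis iota_equiv : forall A, G A ->
  exists2 B, L B & forall p, iota (act A p) = act B (iota p).

Lemma height_image_bounded (c : R) :
  exists d : R, forall q, height q <= c -> height (iota q) <= d.
Proof.
have /compact_near_coveringP cpt := @compact_height_le R 2 c.
have /cpt : forall q, [set q | height q <= c] q ->
    \forall q' \near q & d \near +oo%R, (fun d q => height (iota q) <= d) d q'.
  move=> q _; have hc := continuous_at_comp (@iota_cont q) (@height_continuous R 3).
  have nU : \forall q' \near q, height (iota q') < height (iota q) + 1.
    by apply: (continuous_at_lt hc); rewrite ltrDl.
  exists ([set q' | height (iota q') < height (iota q) + 1],
          [set d | height (iota q) + 1 <= d]).
    by split => //=; exact: nbhs_pinfty_ge (num_real _).
  by move=> [q' d] /= [q'h qd]; apply: le_trans qd; exact: ltW.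
by move=> H; have [d dP] := filter_ex H; exists d => q /dP.
Qed.

Lemma cosh_dist_image A p q : G A ->
  cosh_dist (iota (act A p)) (iota (act A q)) = cosh_dist (iota p) (iota q).
Proof.
by move=> GA; have [B LB BE] := iota_equiv GA; rewrite !BE (cosh_dist_actG _ _ LB).
Qed.

(** Vectors whose rays progress too slowly at some time in [n+1, n+2]. As T < n+3,
    a distance of at most T/6 gives a strict inequality, and the strict inequality
    makes the set open. *)
Definition slow_vectors (n : nat) : set (uthyp R 2) :=
  [set w | exists T, n.+1%:R <= T <= n.+2%:R /\
    cosh_dist (iota (base_point w)) (iota (ray w T)) < expR (6^-1 * n.+3%:R)].

Hypotheses (Gfree : free_action G) (Gcocompact : compact [set: hyp_quotient G]).
Hypotheses (Lfree : free_action L) (Lpd : properly_discontinuous L).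

(** To a slow direction theta attach an element D of G whose translate of the
    fundamental domain contains the point of the ray at the slow time. The point
    iota (D o) then has height O(exp(n/6)), and kappa records the cube in which
    it lies. A cube determines the orbit point, the orbit point determines D by
    injectivity of iota, and D determines theta up to O(exp(- n)). *)
Lemma slow_directions_clustered (r phi : R) : exists2 c : R, 0 < c &
  forall n : nat, exists m : nat, exists kappa : R -> {ffun 'I_3 -> 'I_m.+1},
    m.+1%:R <= c * expR (6^-1 * n%:R) /\
    forall theta theta', slow_vectors n (ut_polar (r, phi, theta)) ->
      slow_vectors n (ut_polar (r, phi, theta')) ->
      kappa theta = kappa theta' -> `|theta - theta'| <= 1 ->
      `|theta - theta'| <= c * expR (- n%:R).
Proof.
pose o := base_point (ut_polar (0 : R, 0 : R, 0 : R)).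
have [R1 R1P] := cocompact_height Gcocompact.
pose R0 := Num.max R1 (height o).
have [C1 C1P] := height_image_bounded R0.
have C1o : height (iota o) <= C1 by apply: C1P; rewrite le_max lexx orbT.
have C1_ge1 := le_trans (height_ge1 (iota o)) C1o.
have [s s0 sP] := orbit_separated Lfree Lpd (iota o).
have [ca ca0 caP] := polar_angle_le (2 * R0 * R0).
pose p := base_point (ut_polar (r, phi, 0)).
have pE theta : base_point (ut_polar (r, phi, theta)) = p.
  by apply: hyp_vec_inj; rewrite !base_pointE.
have hp0 := height_gt0 (iota p).
pose Z n := 8 * height (iota p) * (C1 * C1) * expR (6^-1 * n.+3%:R).
have Z0 n : 0 <= Z n.
  by rewrite /Z !mulr_ge0 ?expR_ge0 ?(ltW hp0)//; lra.
pose c1 := 2 * (8 * height (iota p) * (C1 * C1) * expR (6^-1 * 3)) / s + 1.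
have c1_0 : 0 < c1.
  rewrite /c1 ltr_wpDl// divr_ge0 ?(ltW s0)// !mulr_ge0 ?expR_ge0 ?(ltW hp0)//; lra.
exists (c1 + ca); first exact: addr_gt0.
move=> n; pose m := Num.truncn (2 * Z n / s).
have /choice [D DP] : forall theta, exists D,
    slow_vectors n (ut_polar (r, phi, theta)) ->
    [/\ G D, height (iota (act D o)) <= Z n &
      exists T q, [/\ n.+1%:R <= T, height q <= R0 &
      ray (ut_polar (r, phi, theta)) T = act D q]].
  move=> theta; have [[T [/andP[T1 T2] slow]]|] :=
    pselect (slow_vectors n (ut_polar (r, phi, theta))); last first.
    by move=> nS; exists 1%:M.
  have [A GA AR] := R1P (ray (ut_polar (r, phi, theta)) T).
  exists (invmx A) => _; have GV := isometriesV GA.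
  set q := ray _ T in slow AR *; set q' := act A q in AR *.
  have qE : q = act (invmx A) q' by rewrite /q' (actK _ GA).
  have q'R : height q' <= R0 by rewrite le_max AR.
  split => //; last by exists T, q'.
  rewrite pE in slow.
  have h1 := height_le_cosh_dist (iota q) (iota (act (invmx A) o)).
  have h2 : cosh_dist (iota q) (iota (act (invmx A) o)) <= 2 * C1 * C1.
    rewrite qE cosh_dist_image//; apply: le_trans (cosh_dist_le _ _) _.
    have := C1P _ q'R; have := height_gt0 (iota q'); have := height_gt0 (iota o); nra.
  have h3 := height_le_cosh_dist (iota p) (iota q).
  set E := expR _ in slow; set zz := height (iota (act _ o)) in h1 *.
  set C := cosh_dist _ _ in h1 h2.
  have E0 : 0 < E by exact: expR_gt0.
  have hq0 := height_gt0 (iota q); have C0 : 0 < C := cosh_dist_gt0 _ _.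
  have h4 : height (iota q) <= 2 * height (iota p) * E.
    by apply: le_trans h3 _; rewrite ler_pM2l ?mulr_gt0// ltW.
  apply: le_trans h1 _; rewrite /Z -/E.
  have -> : 8 * height (iota p) * (C1 * C1) * E =
      2 * (2 * height (iota p) * E) * (2 * C1 * C1) by ring.
  by apply: ler_pM => //; rewrite ?mulr_ge0 ?(ltW hq0) ?(ltW C0)// ler_pM2l.
(* Z n is proportional to exp(n/6), and 1 is at most exp(n/6). *)
exists m, (fun theta => grid_cell (Z n) s m (coords (iota (act (D theta) o)))); split.
  have hm : m%:R <= 2 * Z n / s by rewrite /m truncn_le divr_ge0 ?(ltW s0)// mulr_ge0.
  have ZE : 2 * Z n / s = (c1 - 1) * expR (6^-1 * n%:R).
    by rewrite /Z /c1 -[n.+3]addn3 natrD mulrDr expRD; ring.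
  have e1 : 1 <= expR (6^-1 * n%:R) :> R by rewrite -expR0 ler_expR mulr_ge0.
  by rewrite -natr1; move: hm; rewrite ZE; nra.
move=> theta theta' S S' kk x1.
have [GD hD [T [q [T1 hq qE]]]] := DP _ S.
have [GD' hD' [T' [q' [T1' hq' qE']]]] := DP _ S'.
have DD : D theta = D theta'.
  have [B LB BE] := iota_equiv GD; have [B' LB' BE'] := iota_equiv GD'.
  have : act B (iota o) = act B' (iota o).
    apply: sP => // i; rewrite -BE -BE'; apply: (@grid_cellP _ _ (Z n)) => //.
    - exact: le_trans (coord_le_height _ _) hD.
    - exact: le_trans (coord_le_height _ _) hD'.
  rewrite -BE -BE' => /iota_inj oE.
  have GV := isometriesV GD'.
  have : D theta *m invmx (D theta') = 1%:M.
    apply: (act_eq1 Gfree (p := o)); first exact: isometriesM.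
    by rewrite (actM _ GD GV) oE (actK _ GD').
  move=> /(congr1 (mulmx^~ (D theta'))).
  by rewrite -mulmxA (isometriesK GD').2 mulmx1 mul1mx.
have n_lt : n%:R <= n.+1%:R :> R by rewrite ler_nat.
have := @caP r phi theta theta' n.+1%:R T T' _ T1 T1' x1.
rewrite qE qE' DD (cosh_dist_actG _ _ GD') => H.
apply: le_trans (H _ _) _.
- by rewrite ler1n.
- apply: le_trans (cosh_dist_le _ _) _.
  have := height_gt0 q; have := height_gt0 q'; nra.
- by apply: ler_pM; rewrite ?ler_expR ?expR_ge0 ?lerN2// ?(ltW ca0)// lerDr ltW.
Qed.

End equivariant_map.

(** * Measure-theoretic estimates *)

Section measure_generalities.
Import HBNNSimple.

(** Every simple function below the restriction of f to D vanishes outside N, so D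
    may be an arbitrary subset of N. *)
Lemma integral_sub_null d (T : measurableType d) (R : realType)
    (mu : {measure set T -> \bar R}) (f : T -> \bar R) (D N : set T) :
  measurable N -> mu N = 0%E -> D `<=` N -> (forall x, D x -> (0 <= f x)%E) ->
  (\int[mu]_(x in D) f x = 0)%E.
Proof.
move=> mN N0 DN f0; apply/eqP; rewrite eq_le integral_ge0// andbT.
rewrite ge0_integralE//; apply: ge_ereal_sup => _ [g /= gf <-].
have g0 x : ~ N x -> g x = 0.
  move=> Nx; apply/le_anti; rewrite fun_ge0 andbT -lee_fin.
  by apply: le_trans (gf x) _; rewrite patchN// ?notin_setE; move=> // /DN.
have -> : sintegral mu g = (\int[mu]_(x in N) (g x)%:E)%E.
  have -> : sintegral mu g = (\int[mu]_x (g x)%:E)%E.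
    by rewrite integral_nnsfun// patch_setT.
  rewrite [RHS]integral_mkcond; apply: eq_integral => x _.
  by rewrite patchE; case: ifPn => // /negP Nx; rewrite g0// => /mem_set.
by rewrite null_set_integral//; apply/measurable_EFinP; exact: measurable_funTS.
Qed.

Variable R : realType.
Notation borelR := (measurableTypeR R).

(** An open set is the union of the countably many cubes with rational centre and
    radius 1/(k+1) that it contains. *)
Lemma open_measurable_prod3 (U : set (R * R * R)) : open U ->
  measurable (U : set (borelR * borelR * borelR)).
Proof.
move=> oU.
pose box (i : rat * rat * rat * nat) : set (R * R * R) :=
  [set x | ball (ratr i.1.1.1 : R) i.2.+1%:R^-1 x.1.1 /\
           ball (ratr i.1.1.2 : R) i.2.+1%:R^-1 x.1.2 /\
           ball (ratr i.1.2 : R) i.2.+1%:R^-1 x.2].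
have boxE i : box i =
   (ball (ratr i.1.1.1 : R) i.2.+1%:R^-1 `*` ball (ratr i.1.1.2 : R) i.2.+1%:R^-1)
   `*` ball (ratr i.1.2 : R) i.2.+1%:R^-1.
  by apply/seteqP; split => x /= => [[? []]|[[]]].
pose F i := if pselect (box i `<=` U) is left _ then box i else set0.
have -> : U = \bigcup_i F i.
  apply/seteqP; split => [x Ux|x [i _]]; last first.
    by rewrite /F; case: pselect => // iU /iU.
  have /nbhs_ballP[e /= e0 eU] : nbhs x U by apply: open_nbhs_nbhs.
  pose k := Num.truncn (2 / e).
  have k0 : 0 < k.+1%:R^-1 :> R by rewrite invr_gt0.
  have ke : k.+1%:R^-1 + k.+1%:R^-1 <= e.
    have : 2 / e < k.+1%:R by exact: truncnS_gt.
    rewrite ltr_pdivrMr// mulrC => H.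
    have : 2 / k.+1%:R <= e :> R by rewrite ler_pdivrMr// ltW.
    by rewrite mulrDl mul1r.
  have rat_near (y u : R) : 0 < u -> exists q : rat, ball (ratr q : R) u y.
    move=> u0; have /rat_in_itvoo[q] : y - u < y + u by lra.
    rewrite in_itv /= => /andP[q1 q2]; exists q.
    by rewrite -ball_normE /= ltr_norml; lra.
  have [q1 q1x] := rat_near x.1.1 _ k0; have [q2 q2x] := rat_near x.1.2 _ k0.
  have [q3 q3x] := rat_near x.2 _ k0.
  exists (q1, q2, q3, k) => //; rewrite /F; case: pselect => //.
  case => z [/= z1 [z2 z3]]; apply: eU.
  split; [split|]; apply: (le_ball ke).
  - exact: ball_triangle (ball_sym q1x) z1.
  - exact: ball_triangle (ball_sym q2x) z2.
  - exact: ball_triangle (ball_sym q3x) z3.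
apply: countable_bigcupT_measurable => // i.
rewrite /F; case: pselect => // _; rewrite boxE.
apply: measurableX; last exact: measurable_ball.
by apply: measurableX; exact: measurable_ball.
Qed.

Lemma null_of_sections (D : set (borelR * borelR * borelR)) :
  (forall x, lebesgue_measure (xsection D x) = 0%E) ->
  ((@lebesgue_measure R \x @lebesgue_measure R) \x @lebesgue_measure R)%E D = 0%E.
Proof. by move=> D0; apply: integral0_eq => x _; exact: D0. Qed.

(** Each fibre of kappa lies in an interval of radius d around one of its points. *)
Lemma clustered_measure_le (I : finType) (S : set R) (kappa : R -> I) (d : R) :
  0 <= d -> measurable S ->
  (forall x y, S x -> S y -> kappa x = kappa y -> `|x - y| <= d) ->
  (lebesgue_measure S <= (#|I|%:R * (d *+ 2))%:E)%E.
Proof.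
move=> d0 mS Sk.
pose c (i : I) : R := xget 0 [set x | S x /\ kappa x = i].
pose B (i : I) : set R := [set` `[c i - d, c i + d]].
have SB : S `<=` \bigcup_(i in [set: I]) B i.
  move=> x Sx; exists (kappa x) => //.
  have [Sc kc] : S (c (kappa x)) /\ kappa (c (kappa x)) = kappa x.
    by rewrite /c; case: xgetP => [y -> //|/(_ x)[]].
  by have := Sk _ _ Sc Sx kc; rewrite /B /= in_itv /= ler_norml; lra.
have BE i : lebesgue_measure (B i) = (d *+ 2)%:E.
  rewrite /B lebesgue_measure_itv /= lte_fin; case: ltP => [_|cd].
    by rewrite -EFinD; congr EFin; rewrite mulr2n; ring.
  by congr EFin; rewrite mulr2n; lra.
pose F (k : nat) : set R := if insub k is Some j then B (@enum_val I I j) else set0.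
have FE (k : 'I_#|I|) : F k = B (enum_val k) by rewrite /F valK.
have mF k : measurable (F k).
  by rewrite /F; case: insub => [j|]; [exact: measurable_itv|exact: measurable0].
have SF : S `<=` \big[setU/set0]_(k < #|I|) F k.
  move=> x /SB[i _ Bx]; rewrite -bigcup_mkord; exists (enum_rank i) => //=.
  by rewrite FE enum_rankK.
have /le_trans := @content_subadditive _ _ _ (@lebesgue_measure R) S F #|I|
  (fun k _ => mF k) mS SF.
apply; rewrite (eq_bigr (fun=> (d *+ 2)%:E)); last by move=> k _; rewrite FE; exact: BE.
by rewrite sumEFin sumr_const card_ord mulr_natl.
Qed.

End measure_generalities.

(** * Continuity of the geodesic flow *)

Section tangent_continuity.
Variables (R : realType) (n : nat).

Lemma uthyp_vec_continuous : continuous (@uthyp_vec R n).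
Proof. by move=> w; exact: (initial_continuous (f := set_val)). Qed.

Lemma uthyp_vec1_continuous : continuous (fun w : uthyp R n => (uthyp_vec w).1).
Proof.
move=> w; apply: (continuous_at_comp (@uthyp_vec_continuous w)) => z; exact: cvg_fst.
Qed.

Lemma uthyp_vec2_continuous : continuous (fun w : uthyp R n => (uthyp_vec w).2).
Proof.
move=> w; apply: (continuous_at_comp (@uthyp_vec_continuous w)) => z; exact: cvg_snd.
Qed.

Lemma base_point_continuous : continuous (@base_point R n).
Proof.
move=> w; apply: continuous_hyp.
apply: (@eq_continuous_at _ _ (fun w => (uthyp_vec w).1)); last exact: uthyp_vec1_continuous.
by move=> v; rewrite base_pointE.
Qed.

Lemma ray_continuous T : continuous (fun w : uthyp R n => ray w T).
Proof.
move=> w; apply: continuous_hyp.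
apply: (@eq_continuous_at _ _
  (fun w => cosh T *: (uthyp_vec w).1 + sinh T *: (uthyp_vec w).2)).
  by move=> v; rewrite ray_vec.
have sc (c : R) : continuous (fun v : 'rV[R]_n.+1 => c *: v) by exact: scaler_continuous.
have c1 := continuous_at_comp (@uthyp_vec1_continuous w) (sc (cosh T)).
have c2 := continuous_at_comp (@uthyp_vec2_continuous w) (sc (sinh T)).
exact: continuousD c1 c2.
Qed.

End tangent_continuity.

Section polar_continuity.
Variable R : realType.

Lemma continuous_cosh : continuous (@cosh R).
Proof.
move=> t; have e : continuous_at t (fun t : R => expR (- t)).
  apply: (@continuous_at_comp R R R (fun t => - t) expR); last exact: continuous_expR.
  exact: opp_continuous.
exact: continuousM (continuousD (@continuous_expR R t) e) (@cst_continuous R R _ t).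
Qed.

Lemma continuous_sinh : continuous (@sinh R).
Proof.
move=> t; have e : continuous_at t (fun t : R => expR (- t)).
  apply: (@continuous_at_comp R R R (fun t => - t) expR); last exact: continuous_expR.
  exact: opp_continuous.
exact: continuousM (continuousB (@continuous_expR R t) e) (@cst_continuous R R _ t).
Qed.

Lemma continuous_row3 (X : topologicalType) (a b c : X -> R) x :
  continuous_at x a -> continuous_at x b -> continuous_at x c ->
  continuous_at x (fun y => row3 (a y) (b y) (c y)).
Proof.
move=> ac bc cc; apply: continuous_mx_entries => i [[|[|[|//]]] j3].
- by apply: eq_continuous_at ac => y; rewrite mxE.
- by apply: eq_continuous_at bc => y; rewrite mxE.
- by apply: eq_continuous_at cc => y; rewrite mxE.
Qed.

Lemma ut_polar_continuous : continuous (@ut_polar R).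
Proof.
move=> x; apply: continuous_set_type.
pose X := (R * R * R)%type.
have cr : continuous_at x (fun c : X => c.1.1).
  apply: (@continuous_at_comp X (R * R)%type R fst fst); first exact: cvg_fst.
  by move=> z; exact: cvg_fst.
have cphi : continuous_at x (fun c : X => c.1.2).
  apply: (@continuous_at_comp X (R * R)%type R fst snd); first exact: cvg_fst.
  by move=> z; exact: cvg_snd.
have cth : continuous_at x (fun c : X => c.2) by exact: cvg_snd.
have cch := continuous_at_comp cr continuous_cosh.
have csh := continuous_at_comp cr continuous_sinh.
have ccp := continuous_at_comp cphi (@continuous_cos R).
have csp := continuous_at_comp cphi (@continuous_sin R).
have cct := continuous_at_comp cth (@continuous_cos R).
have cst := continuous_at_comp cth (@continuous_sin R).
apply: (@eq_continuous_at _ _ (fun c : X =>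
  (row3 (cosh c.1.1) (sinh c.1.1 * cos c.1.2) (sinh c.1.1 * sin c.1.2),
   cos c.2 *: row3 (sinh c.1.1) (cosh c.1.1 * cos c.1.2) (cosh c.1.1 * sin c.1.2)
   + sin c.2 *: row3 0 (- sin c.1.2) (cos c.1.2)))).
  by case=> [[r phi] theta].
apply: continuous_at_pair.
  exact: (continuous_row3 cch (continuousM csh ccp) (continuousM csh csp)).
have sc (a : X -> R) (v : X -> 'rV[R]_3) : continuous_at x a -> continuous_at x v ->
    continuous_at x (fun c => a c *: v c).
  move=> ac vc; apply: continuous_mx_entries => i j.
  apply: (@eq_continuous_at _ _ (fun c => a c * v c i j)); first by move=> c; rewrite mxE.
  have vij : continuous_at x (fun c => v c i j).
    apply: (@continuous_at_comp X 'rV[R]_3 R v (fun M => M i j)) => //.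
    exact: coord_continuous.
  exact: continuousM ac vij.
have r1 := continuous_row3 csh (continuousM cch ccp) (continuousM cch csp).
have r2 := continuous_row3 (@cst_continuous X R 0 x) (continuousN csp) ccp.
exact: continuousD (sc _ _ cct r1) (sc _ _ cst r2).
Qed.

End polar_continuity.

Section slow_vectors_topology.
Variables (R : realType) (G : isometry_group R 2) (L : isometry_group R 3).
Variable iota : hyp R 2 -> hyp R 3.

(** At a fixed time T, slowness is an open condition on the vector. *)
Lemma slow_vectors_open n : continuous iota -> open (slow_vectors iota n).
Proof.
move=> ic; have -> : slow_vectors iota n =
  \bigcup_(T in [set T : R | n.+1%:R <= T <= n.+2%:R])
   ((fun w => cosh_dist (iota (base_point w)) (iota (ray w T))) @^-1`
     [set x | x < expR (6^-1 * n.+3%:R)]).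
  by apply/seteqP; split => w [T]; [case=> TI sl; exists T|exists T].
apply: bigcup_open => T _; apply: open_comp; last exact: open_lt.
move=> w _; apply: continuous_cosh_dist.
  exact: continuous_at_comp (@base_point_continuous R 2 w) ic.
exact: continuous_at_comp (@ray_continuous R 2 T w) ic.
Qed.

Lemma ut_projP (w w' : uthyp R 2) : ut_proj G w = ut_proj G w' ->
  exists2 A, G A & base_point w' = act A (base_point w) /\
    forall T, ray w' T = act A (ray w T).
Proof.
move=> /eqmodP/asboolP[A GA wE]; exists A => //; split => [|T]; apply: hyp_vec_inj.
  by rewrite (act_vecG _ GA) !base_pointE wE.
by rewrite (act_vecG _ GA) !ray_vec wE /= mulmxDl !scalemxAl.
Qed.

Lemma slow_vectors_invariant n w w' :
  (forall A, G A -> exists2 B, L B & forall p, iota (act A p) = act B (iota p)) ->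
  ut_proj G w = ut_proj G w' -> slow_vectors iota n w -> slow_vectors iota n w'.
Proof.
move=> ie /ut_projP[A GA [bE rE]] [T [TI sl]]; exists T; split => //.
by rewrite bE rE (cosh_dist_image ie).
Qed.

End slow_vectors_topology.

(** * Almost every direction is fast *)

Lemma geometric_nneseries_lty (R : realType) (a x : R) : 0 <= a -> 0 < x -> x < 1 ->
  (\sum_(0 <= n <oo) (a * x ^+ n)%:E < +oo)%E.
Proof.
move=> a0 x0 x1; apply: le_lt_trans (ltry (a * (1 - x)^-1)).
have t0 n : (0 <= (a * x ^+ n)%:E)%E by rewrite lee_fin mulr_ge0// exprn_ge0// ltW.
apply: lime_le; first by apply: is_cvg_nneseries => n _ _.
apply: nearW => n; rewrite sumEFin lee_fin.
by apply: geometric_le_lim => //; rewrite gtr0_norm.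
Qed.

Section slow_null.
Variables (R : realType) (G : isometry_group R 2) (L : isometry_group R 3).
Variable iota : hyp R 2 -> hyp R 3.
Hypotheses (iota_cont : continuous iota) (iota_inj : injective iota).
Hypothesis iota_equiv : forall A, G A ->
  exists2 B, L B & forall p, iota (act A p) = act B (iota p).
Hypotheses (Gfree : free_action G) (Gcocompact : compact [set: hyp_quotient G]).
Hypotheses (Lfree : free_action L) (Lpd : properly_discontinuous L).

Definition slow_directions (r phi : R) (n : nat) : set R :=
  [set theta | 0 <= theta < 2 * pi /\ slow_vectors iota n (ut_polar (r, phi, theta))].

Lemma measurable_slow_directions r phi n : measurable (slow_directions r phi n).
Proof.
have -> : slow_directions r phi n = [set` `[0, 2 * pi[] `&`
    ((fun theta => ut_polar (r, phi, theta)) @^-1` slow_vectors iota n).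
  by apply/seteqP; split => x; rewrite /slow_directions /= in_itv.
apply: measurableI; first exact: measurable_itv.
apply: open_measurable; apply: open_comp; last exact: slow_vectors_open.
move=> x _; apply: (continuous_at_comp (g := @ut_polar R)); last exact: ut_polar_continuous.
by apply: continuous_at_pair; [exact: cst_continuous|exact: cvg_id].
Qed.

(** By clustering, the n-th set of slow directions is covered by O(exp(n/2))
    intervals of length O(exp(- n)): Borel-Cantelli applies. *)
Lemma slow_directions_null r phi :
  lebesgue_measure (lim_sup_set (slow_directions r phi)) = 0%E.
Proof.
apply: lim_sup_set_cvg0; first exact: measurable_slow_directions.
have [c c0 cP] := slow_directions_clustered iota_cont iota_inj iota_equiv
  Gfree Gcocompact Lfree Lpd r phi.
have pi8 : 2 * pi <= 8 :> R by have := @pihalf_lt2 R; lra.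
apply: le_lt_trans (@geometric_nneseries_lty R (16 * c ^+ 4) (expR (- 2^-1)) _ _ _).
- apply: lee_nneseries => n _ //.
  have [m [kappa [mc clu]]] := cP n.
  (* Clustering holds for directions at most 1 apart; as 2 pi <= 8, the integral
     part of theta separates the others. *)
  pose I : finType := ('I_8 * {ffun 'I_3 -> 'I_m.+1})%type.
  pose kappa' (theta : R) : I := (inord (Num.truncn theta), kappa theta).
  apply: le_trans (@clustered_measure_le R I _ kappa' (c * expR (- n%:R)) _
    (measurable_slow_directions r phi n) _) _.
  + by rewrite mulr_ge0 ?expR_ge0// ltW.
  + move=> x y [/andP[x0 x8] xs] [/andP[y0 y8] ys] /eqP; rewrite xpair_eqE.
    move=> /andP[/eqP/(congr1 val)/= txy /eqP kxy]; apply: clu => //.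
    move: txy; rewrite !inordK.
    * have /andP[] := truncn_itv x0; have /andP[] := truncn_itv y0.
      by rewrite -!natr1 ler_norml => ? ? + + E; rewrite E; lra.
    * by rewrite truncn_lt_nat//; lra.
    * by rewrite truncn_lt_nat//; lra.
  + rewrite card_prod card_ord card_ffun !card_ord lee_fin natrM natrX.
    have -> : - 2^-1 = 3 * 6^-1 - 1 :> R by lra.
    set e := expR (6^-1 * n%:R) in mc.
    have -> : expR (3 * 6^-1 - 1 : R) ^+ n = e ^+ 3 * expR (- n%:R).
      rewrite -expRM_natl -expRM_natl -expRD; congr expR; ring.
    have e0 : 0 < e := expR_gt0 _.
    have f0 := expR_gt0 (- n%:R : R).
    have : m.+1%:R ^+ 3 <= (c * e) ^+ 3.
      by rewrite lerXn2r// nnegrE ?ler0n// mulr_ge0 ?ltW.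
    rewrite exprMn => h3.
    have -> : 16 * c ^+ 4 * (e ^+ 3 * expR (- n%:R)) =
      8 * (c ^+ 3 * e ^+ 3) * (c * expR (- n%:R) *+ 2) by rewrite mulr2n; ring.
    apply: ler_wpM2r; first by rewrite mulrn_wge0// mulr_ge0 ?ltW.
    by rewrite ler_pM2l.
- by rewrite mulr_ge0// exprn_ge0// ltW.
- exact: expR_gt0.
- by rewrite -[ltRHS]expR0 ltr_expR; lra.
Qed.

Definition slow_polar (n : nat) : set (R * R * R) :=
  [set c | 0 <= c.2 < 2 * pi /\ slow_vectors iota n (ut_polar c)].

Notation borelR := (measurableTypeR R).

Lemma measurable_slow_polar n :
  measurable (slow_polar n : set (borelR * borelR * borelR)).
Proof.
have -> : slow_polar n = ([set: R * R] `*` [set` `[0, 2 * pi[]) `&`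
    (@ut_polar R @^-1` slow_vectors iota n).
  by apply/seteqP; split => -[x t]; rewrite /slow_polar /= in_itv /=; tauto.
apply: measurableI.
  by apply: measurableX => //; exact: measurable_itv.
apply: open_measurable_prod3; apply: open_comp; last exact: slow_vectors_open.
by move=> x _; exact: ut_polar_continuous.
Qed.

Lemma measurable_lim_sup_set d (T : measurableType d) (F : (set T)^nat) :
  (forall n, measurable (F n)) -> measurable (lim_sup_set F).
Proof.
by move=> mF; apply: bigcap_measurable => // n _; apply: bigcup_measurable => k _.
Qed.

Lemma slow_polar_null :
  ((@lebesgue_measure R \x @lebesgue_measure R) \x @lebesgue_measure R)%E
    (lim_sup_set slow_polar) = 0%E.
Proof.
apply: null_of_sections => -[r phi].
rewrite -[RHS](slow_directions_null r phi); congr (lebesgue_measure _).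
apply/seteqP; split => theta.
  by rewrite /xsection /= inE => H n _; have [k nk [? ?]] := H n I; exists k.
by move=> H; rewrite /xsection /= inE => n _; have [k nk [? ?]] := H n I; exists k.
Qed.

Lemma slow_liouville_null :
  liouville (lim_sup_set (fun n => ut_proj G @` slow_vectors iota n)) = 0%E.
Proof.
rewrite /liouville; apply: (@integral_sub_null _ (borelR * borelR * borelR)%type R
  ((@lebesgue_measure R \x @lebesgue_measure R) \x @lebesgue_measure R)%E
  _ _ (lim_sup_set slow_polar)).
- by apply: measurable_lim_sup_set; exact: measurable_slow_polar.
- exact: slow_polar_null.
- move=> c [[_ _ c2 _] H] n _; have [k nk [w ws we]] := H n I.
  by exists k => //; split => //; exact: slow_vectors_invariant iota_equiv we ws.
- by move=> c [[c1 _ _ _] _]; rewrite lee_fin; have [] := sinh_le_cosh c1.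
Qed.

Lemma measurable_slow_classes n :
  measurable (ut_proj G @` slow_vectors iota n : set (ut_borel G)).
Proof.
apply: sub_sigma_algebra; rewrite /open /= /quotient_open.
have -> : \pi_(ut_quotient G) @^-1` (ut_proj G @` slow_vectors iota n) =
    slow_vectors iota n.
  apply/seteqP; split => [w [w' ws we]|w ws]; last by exists w.
  exact: slow_vectors_invariant iota_equiv we ws.
exact: slow_vectors_open.
Qed.

(** If v is not fast, then for arbitrarily large T some w over v satisfies
    d <= T/6, whence cosh d <= exp(T/6); the set with index floor(T) - 1
    witnesses this. *)
Lemma not_fast_slow (v : ut_quotient G) :
  ~ (exists T0 : R, forall T : R, T0 <= T ->
      forall w : uthyp R 2, ut_proj G w = v ->
        6^-1 * T < hyp_dist (iota (base_point w))
                            (iota (base_point (geodesic_flow T w)))) ->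
  lim_sup_set (fun n => ut_proj G @` slow_vectors iota n) v.
Proof.
move=> nfast n _; apply: contrapT => nslow; apply: nfast.
exists n.+1%:R => T nT w wv; rewrite ltNge; apply/negP => slow; apply: nslow.
have T0 : 0 <= T by apply: le_trans nT.
have /andP[tT Tt] := truncn_itv T0.
have nt : (n.+1 <= Num.truncn T)%N by rewrite -ltnS -(ltr_nat R); exact: le_lt_trans nT Tt.
exists (Num.truncn T).-1; first by rewrite /= -ltnS prednK// (leq_ltn_trans _ nt).
exists w => //; exists T; rewrite prednK; last exact: leq_ltn_trans nt.
split; first by rewrite tT ltW.
have C0 := cosh_dist_gt0 (iota (base_point w)) (iota (ray w T)).
rewrite -[ltLHS]lnK ?posrE// ltr_expR.
apply: (@le_lt_trans _ _ (6^-1 * T)); last first.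
  by rewrite ltr_pM2l// (lt_trans Tt)// ltr_nat.
apply: le_trans slow; rewrite /hyp_dist /arcosh -/(cosh_dist _ _).
by rewrite ler_ln ?posrE ?ltr_pwDl ?sqrtr_ge0// lerDl sqrtr_ge0.
Qed.

End slow_null.

Theorem theorem2p2 (R : realType)
    (G : isometry_group R 2) (L : isometry_group R 3)
    (S_closed : closed_hyperbolic_manifold G) (S_orientable : orientable G)
    (M_closed : closed_hyperbolic_manifold L)
    (f : homeomorphism (hyp_quotient G) (hyp_quotient G))
    (h : homeomorphism (mapping_torus R f) (hyp_quotient L))
    (iota : hyp R 2 -> hyp R 3) (iota_lift : fibre_lift h iota) :
  exists2 k : R, 0 < k &
    {ae @liouville R G, forall v : ut_borel G,
      exists T0 : R, forall T : R, T0 <= T ->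
        forall w : uthyp R 2, ut_proj G w = v ->
          k * T < hyp_dist (iota (base_point w))
                           (iota (base_point (geodesic_flow T w)))}.
Proof.
have [Gfree Gpd Gcpt] := S_closed; have [Lfree Lpd _] := M_closed.
have iota_inj := fibre_lift_injective Gfree Gpd iota_lift.
have [iota_cont _ equiv] := iota_lift.
have iota_equiv A : G A -> exists2 B, L B & forall p, iota (act A p) = act B (iota p).
  move=> GA; have [B LB BE] := equiv A GA; exists B => // p.
  apply: hyp_vec_inj; rewrite (act_vecG _ LB); apply: BE; exact: act_vecG GA.
exists 6^-1; first by rewrite invr_gt0.
exists (lim_sup_set (fun n => ut_proj G @` slow_vectors iota n)); split.
- exact: (measurable_lim_sup_set (measurable_slow_classes iota_cont iota_equiv)).
- exact: (slow_liouville_null iota_cont iota_inj iota_equiv Gfree Gcpt Lfree Lpd).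
- by move=> v; exact: not_fast_slow.
Qed.
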